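(* Let $N=\overline{B}_u\times\overline{B}_s$ and let $F$ be a $C^1$ vector field, defined on an open set of $\mathbb{R}^u\times\mathbb{R}^s$ containing $N$, with $F(0)=0$, such that for some constants $\mu,L,M$: $\|F(p)\|\le\mu$ and $\|DF(p)\|\le L$ for all $p\in N$, and $\|DF(p_1)-DF(p_2)\|\le M\|p_1-p_2\|$ for all $p_1,p_2\in N$. Assume that $$[DF(N)]\subset\begin{pmatrix}\mathbf{A}&\boldsymbol{\varepsilon}_1\\ \boldsymbol{\varepsilon}_2&\mathbf{B}\end{pmatrix},$$ where $\mathbf{A},\mathbf{B},\boldsymbol{\varepsilon}_1,\boldsymbol{\varepsilon}_2$ are interval matrices (of sizes $u\times u$, $s\times s$, $u\times s$, $s\times u$ respectively). Let $\alpha_h,\alpha_v\in(0,1)$ and let $c_h,c_v\in\mathbb{R}$ be such that for any $A\in\mathbf{A}$, $B\in\mathbf{B}$, $\varepsilon_1\in\boldsymbol{\varepsilon}_1$, $\varepsilon_2\in\boldsymbol{\varepsilon}_2$, all $x\in\mathbb{R}^u\setminus\{0\}$ and all $y\in\mathbb{R}^s\setminus\{0\}$, $$x^T\Big(A-\tfrac12\big(\|\varepsilon_1\|+\tfrac{1}{\alpha_h}\|\varepsilon_2\|\big)\mathrm{Id}\Big)x>c_h\|x\|^2,$$ $$x^T\Big(A-\tfrac12\big(\|\varepsilon_1\|+\alpha_v\|\varepsilon_2\|\big)\mathrm{Id}\Big)x>c_v\|x\|^2,$$ $$y^T\Big(B+\tfrac12\big(\|\varepsilon_2\|+\alpha_h\|\varepsilon_1\|\big)\mathrm{Id}\Big)y<c_h\|y\|^2,$$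 $$y^T\Big(B+\tfrac12\big(\|\varepsilon_2\|+\tfrac{1}{\alpha_v}\|\varepsilon_1\|\big)\mathrm{Id}\Big)y<c_v\|y\|^2.$$ Let $r^u=\sqrt{1-\alpha_v}$ and $U=\overline{B}_u(0,r^u)\times\overline{B}_s$. If $c_v>c_h$ and $c_v>0$, then there exists a function $w^u:\overline{B}_u(0,r^u)\to\overline{B}_s$ such that $$W^u_{c_v,N}\cap U=\{(x,w^u(x)) : x\in\overline{B}_u(0,r^u)\}.$$ Moreover, $w^u$ is Lipschitz with constant $L_u=\sqrt{\alpha_h}$.
   Context: Vector norms are Euclidean, matrix norms are the induced operator norms. $B_k(x,r)$ is the open ball in $\mathbb{R}^k$ of radius $r$ centered at $x$, $B_k=B_k(0,1)$, and bars denote closures. An interval matrix is a matrix whose entries are closed bounded intervals, identified with the set of real matrices whose entries lie in the corresponding intervals. The interval enclosure of the derivative on $N$ is $$[DF(N)]=\Big\{A\in\mathbb{R}^{(u+s)\times(u+s)} : A_{ij}\in\Big[\inf_{p\in N}\tfrac{\partial F_i}{\partial p_j}(p),\ \sup_{p\in N}\tfrac{\partial F_i}{\partial p_j}(p)\Big]\text{ for all }i,j\Big\}.$$ $\phi_t(p)$ denotes the (local) flow of the ODE $p'=F(p)$. Strong unstable manifold for the flow: for a neighborhood $V$ of zero and $\lambda>0$, $W^u_{\lambda,V}$ is the set of all points $p$ such that (1) $\phi_t(p)\in V$ for all $t\le 0$; and (2) there exists a constant $C>0$ (which can depend on $p$) such that $\|\phi_t(p)\|\le Ce^{t\lambda}$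 for all $t\le 0$. Here $V=N$ and $\lambda=c_v$. *)

(* Defs.v *)
From mathcomp Require Export all_boot all_order all_algebra.
From mathcomp Require Export all_classical all_reals all_analysis.

Set Implicit Arguments.
Unset Strict Implicit.
Unset Printing Implicit Defensive.

Export Order.TTheory GRing.Theory Num.Theory.
Export numFieldNormedType.Exports.

Local Open Scope classical_set_scope.
Local Open Scope ring_scope.

(* R^k is 'cV[R]_k.  The library norm `|x| on matrices is the sup norm; it
   induces the same topology, hence the same closure, differentiability and
   continuity, as the Euclidean norm. *)
Definition enorm (R : realType) (k : nat) (x : 'cV[R]_k) : R :=
  Num.sqrt (\sum_(i < k) x i 0 ^+ 2).

Definition opnorm (R : realType) (m n : nat) (A : 'M[R]_(m, n)) : R :=
  sup [set enorm (A *m x) | x in [set x : 'cV[R]_n | enorm x <= 1]].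

Definition eball (R : realType) (k : nat) (x : 'cV[R]_k) (r : R) :
    set 'cV[R]_k :=
  [set y | enorm (y - x) < r].

Definition closed_eball (R : realType) (k : nat) (x : 'cV[R]_k) (r : R) :
    set 'cV[R]_k :=
  closure (eball x r).

(* R^u x R^s is identified with R^(u + s), the pair (x, y) being col_mx x y. *)
Definition prod_set (R : realType) (u s : nat)
    (X : set 'cV[R]_u) (Y : set 'cV[R]_s) : set 'cV[R]_(u + s) :=
  [set p | X (usubmx p) /\ Y (dsubmx p)].

Definition Dmx (R : realType) (n : nat) (F : 'cV[R]_n -> 'cV[R]_n)
    (p : 'cV[R]_n) : 'M[R]_n :=
  \matrix_(i, j) ('D_(delta_mx j 0) F p) i 0.

(* F is total; only its restriction to the open set Om is meaningful. *)
Definition C1_on (R : realType) (n : nat) (Om : set 'cV[R]_n)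
    (F : 'cV[R]_n -> 'cV[R]_n) : Prop :=
  forall p, Om p -> differentiable F p /\ {for p, continuous (Dmx F)}.

Definition interval_matrix (R : realType) (m n : nat) (S : set 'M[R]_(m, n)) :
    Prop :=
  exists lo hi : 'M[R]_(m, n),
    (forall i j, lo i j <= hi i j) /\
    S = [set A | forall i j, lo i j <= A i j <= hi i j].

Definition block_set (R : realType) (u s : nat)
    (Aul : set 'M[R]_(u, u)) (Aur : set 'M[R]_(u, s))
    (Adl : set 'M[R]_(s, u)) (Adr : set 'M[R]_(s, s)) : set 'M[R]_(u + s) :=
  [set M | [/\ Aul (ulsubmx M), Aur (ursubmx M),
               Adl (dlsubmx M) & Adr (drsubmx M)]].

Definition interval_enclosure (R : realType) (n : nat)
    (F : 'cV[R]_n -> 'cV[R]_n) (V : set 'cV[R]_n) : set 'M[R]_n :=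
  [set A | forall i j,
    inf [set Dmx F p i j | p in V] <= A i j
      <= sup [set Dmx F p i j | p in V]].

(* x^T M x *)
Definition qform (R : realType) (k : nat) (M : 'M[R]_k) (x : 'cV[R]_k) : R :=
  (x^T *m M *m x) 0 0.

(* [flow Om F t p q] : phi_t(p) is defined and equal to q, where phi is the
   local flow of p' = F(p) on Om.  The interval ]a, b[ is any open interval of
   existence containing 0 and t; q is unique when F is C^1 on the open set
   Om. *)
Definition flow (R : realType) (n : nat) (Om : set 'cV[R]_n)
    (F : 'cV[R]_n -> 'cV[R]_n) (t : R) (p q : 'cV[R]_n) : Prop :=
  exists (g : R -> 'cV[R]_n) (a b : R),
    [/\ a < 0 < b, a < t < b, g 0 = p, g t = q &
        forall r, a < r < b -> Om (g r) /\ is_derive r 1 g (F (g r))].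

Definition strong_unstable (R : realType) (n : nat) (Om : set 'cV[R]_n)
    (F : 'cV[R]_n -> 'cV[R]_n) (V : set 'cV[R]_n) (lambda : R) :
    set 'cV[R]_n :=
  [set p |
    (forall t, t <= 0 -> exists2 q, flow Om F t p q & V q) /\
    (exists2 C : R, 0 < C &
       forall t q, t <= 0 -> flow Om F t p q ->
         enorm q <= C * expR (t * lambda))].

(* Main.v *)
Require Import Defs.
From mathcomp Require Import all_boot all_order all_algebra.
From mathcomp Require Import all_classical all_reals all_analysis.
From mathcomp Require Import ring lra.

Set Implicit Arguments.
Unset Strict Implicit.
Unset Printing Implicit Defensive.

Local Open Scope classical_set_scope.
Local Open Scope ring_scope.

Import Order.TTheory GRing.Theory Num.Theory.

(** The argument is the classical invariant cone argument, carried out for a vector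
    field that satisfies the cone conditions on the whole space.

    Write [z = (x, y)] and [cone_form b z = |x|^2 - b * |y|^2]. The two conditions with
    [c_h] and [c_v] say that, for [b = 1 / alpha_h] and [b = alpha_v], this form of the
    difference of two solutions in [N] grows at least like [exp (2 * c * t)] with
    [c = c_h] and [c = c_v] respectively ([cone_rate], [cone_form_growth]).

    Global extension. By the mean value theorem in each row, [F p - F q = A *m (p - q)]
    on [N] for some [A] in the interval enclosure. A McShane extension whose distance
    is the support function of that box of matrices yields a field [G] on the whole
    space which equals [F] on [N] and has the same property everywhere
    ([field_extension]). So [G] is globally Lipschitz, its solutions exist for all times
    ([picard]), and the cone inequalities hold globally, whether or not the solutions
    leave [N]. Uniqueness of solutions identifies the manifold with the points whose
    backward [G]-curve stays in [N] and decays
    ([strong_unstable_curve], [curve_strong_unstable]).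

    Uniqueness and Lipschitz constant. If the difference of two points of the manifold
    had a negative [1 / alpha_h]-form, then backward in time this form would stay
    above a positive multiple of [exp (2 * c_h * t)] in modulus, whereas the points
    approach each other like [exp (c_v * t)]; this contradicts [c_h < c_v]
    ([strong_unstable_cone]).
    So [|y1 - y2|^2 <= alpha_h * |x1 - x2|^2].

    Existence. There are arbitrarily large [T] such that above each [x] ends, at time
    [0], a [G]-curve that starts on [y = 0] at time [- T]. This is proved by a graph transform with
    short fixed time steps, each solved by a contraction ([reaches_step]). Letting [T]
    tend to infinity gives a curve through a point above [x] that stays in the cone
    for all negative times ([backward_cone_curve]). On the cone the [alpha_v]-form is at
    least [(1 - alpha_v) * |x|^2], and it decays backward like [exp (2 * c_v * t)]; if
    [|x|^2 <= 1 - alpha_v], the curve therefore remains in [N] and has the required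
    decay ([cone_curve_decay]). *)

(** * Euclidean and sup norms *)

Definition sqn (R : realType) (k : nat) (x : 'cV[R]_k) : R :=
  \sum_(i < k) x i 0 ^+ 2.

Section Norms.
Context {R : realType}.

Lemma sqn_ge0 k (x : 'cV[R]_k) : 0 <= sqn x.
Proof. by apply: sumr_ge0 => i _; rewrite sqr_ge0. Qed.

Lemma sqr_enorm k (x : 'cV[R]_k) : enorm x ^+ 2 = sqn x.
Proof. by rewrite /enorm sqr_sqrtr// sqn_ge0. Qed.

Lemma enorm_ge0 k (x : 'cV[R]_k) : 0 <= enorm x.
Proof. exact: sqrtr_ge0. Qed.

Lemma enorm_le k (x : 'cV[R]_k) r : 0 <= r -> (enorm x <= r) = (sqn x <= r ^+ 2).
Proof.
by move=> r0; rewrite -(@ler_pXn2r _ 2)// ?nnegrE ?enorm_ge0// sqr_enorm.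
Qed.

Lemma enorm_lt k (x : 'cV[R]_k) r : 0 < r -> (enorm x < r) = (sqn x < r ^+ 2).
Proof.
by move=> r0; rewrite -(@ltr_pXn2r _ 2)// ?nnegrE ?enorm_ge0// ?(ltW r0)// sqr_enorm.
Qed.

Lemma coord_le_norm k (x : 'cV[R]_k) i : `|x i 0| <= `|x|.
Proof.
rewrite [leRHS]/Num.norm/= mx_normrE; exact: (le_bigmax _ (fun ij => `|x ij.1 ij.2|) (i, 0)).
Qed.

Lemma norm_le_coord k (x : 'cV[R]_k) e :
  0 <= e -> (forall i, `|x i 0| <= e) -> `|x| <= e.
Proof.
move=> e0 h; rewrite [leLHS]/Num.norm/= mx_normrE; apply: bigmax_le => //= -[i j] _ /=.
by rewrite (ord1 j).
Qed.

Lemma sqn_le_norm k (x : 'cV[R]_k) : sqn x <= k%:R * `|x| ^+ 2.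
Proof.
have -> : k%:R * `|x| ^+ 2 = \sum_(i < k) `|x| ^+ 2 by rewrite sumr_const card_ord mulr_natl.
apply: ler_sum => i _.
by rewrite -real_normK ?num_real// lerXn2r ?nnegrE// coord_le_norm.
Qed.

Lemma coord_le_sqn k (x : 'cV[R]_k) i : x i 0 ^+ 2 <= sqn x.
Proof.
by rewrite /sqn (bigD1 i)//= lerDl sumr_ge0// => j _; rewrite sqr_ge0.
Qed.

Lemma norm_le_enorm k (x : 'cV[R]_k) : `|x| <= enorm x.
Proof.
apply: norm_le_coord; first exact: enorm_ge0.
move=> i; rewrite -(@ler_pXn2r _ 2)// ?nnegrE ?enorm_ge0//.
by rewrite sqr_enorm real_normK ?num_real// coord_le_sqn.
Qed.

Lemma normsq_le_sqn k (x : 'cV[R]_k) : `|x| ^+ 2 <= sqn x.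
Proof. by rewrite -sqr_enorm lerXn2r ?nnegrE ?enorm_ge0// norm_le_enorm. Qed.

Lemma sqn0 k : sqn (0 : 'cV[R]_k) = 0.
Proof. by rewrite /sqn big1// => i _; rewrite mxE expr0n. Qed.

Lemma sqn_eq0 k (x : 'cV[R]_k) : sqn x <= 0 -> x = 0.
Proof.
move=> x0; apply/eqP; rewrite -normr_le0.
by have := le_trans (normsq_le_sqn x) x0; rewrite exprn_even_le0//= => /eqP ->.
Qed.

Lemma sqnZ k a (x : 'cV[R]_k) : sqn (a *: x) = a ^+ 2 * sqn x.
Proof. by rewrite /sqn mulr_sumr; apply: eq_bigr => i _; rewrite mxE exprMn. Qed.

Lemma enormZ k a (x : 'cV[R]_k) : enorm (a *: x) = `|a| * enorm x.
Proof. by rewrite /enorm -/(sqn _) sqnZ sqrtrM ?sqr_ge0// sqrtr_sqr. Qed.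

Lemma sqn_add_le k (x y : 'cV[R]_k) : sqn (x + y) <= 2 * (sqn x + sqn y).
Proof.
rewrite /sqn -big_split/= mulr_sumr; apply: ler_sum => i _; rewrite mxE.
have := sqr_ge0 (x i 0 - y i 0); lra.
Qed.

Lemma sqnN k (x : 'cV[R]_k) : sqn (- x) = sqn x.
Proof. by rewrite /sqn; apply: eq_bigr => i _; rewrite mxE sqrrN. Qed.

Lemma continuous_sum (T : topologicalType) (I : Type) (r : seq I) (f : I -> T -> R) :
  (forall i, continuous (f i)) -> continuous (fun x => \sum_(i <- r) f i x).
Proof.
move=> fc; elim: r => [|i r ih].
  by under eq_fun do rewrite big_nil; exact: cst_continuous.
under eq_fun do rewrite big_cons.
by move=> x; apply: continuousD; [exact: fc|exact: ih].
Qed.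

Lemma continuous_coord k i : continuous (fun x : 'cV[R]_k => x i 0).
Proof. by move=> x; apply: coord_continuous. Qed.

Lemma sqn_continuous k : continuous (@sqn R k).
Proof.
apply: continuous_sum => i x /=.
by under eq_fun do rewrite expr2; apply: continuousM; exact: continuous_coord.
Qed.

(** The sublevel set is closed; conversely each of its points is the limit of its
    multiples by [1 - t], which lie in the open ball. *)
Lemma closed_eballE k (r : R) : 0 < r ->
  closed_eball (0 : 'cV[R]_k) r = [set x | sqn x <= r ^+ 2].
Proof.
move=> r0; apply/seteqP; split => x /=.
  have cl : closed [set x : 'cV[R]_k | sqn x <= r ^+ 2].
    apply: (@preimage_closed _ _ (@sqn R k) [set z | z <= r ^+ 2]).
      by move=> z _; exact: sqn_continuous.
    exact: closed_le.
  move=> xc; apply: cl; apply: closureS xc => y /=.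
  by rewrite /eball /= subr0 enorm_lt// => /ltW.
move=> xr B Bx.
have : (fun t : R => (1 - t) *: x) t @[t --> (0:R)] --> x.
  rewrite -[X in _ --> X]scale1r -[X in X *: _](subr0 1).
  by apply: cvgZr_tmp; apply: cvgB; [exact: cvg_cst|exact: cvg_id].
move=> /(_ B Bx) /= -[e /= e0 eB].
pose t := Num.min (e / 2) (2^-1).
have t0 : 0 < t by rewrite /t lt_min divr_gt0//= invr_gt0.
have th : t <= 2^-1 by rewrite /t ge_min lexx orbT.
have te : t <= e / 2 by rewrite /t ge_min lexx.
exists ((1 - t) *: x); split.
  rewrite /eball/= subr0 enorm_lt// sqnZ.
  apply: (@le_lt_trans _ _ ((1 - t) ^+ 2 * r ^+ 2)).
    by rewrite ler_wpM2l// sqr_ge0.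
  by rewrite gtr_pMl ?exprn_gt0//; nra.
by apply: eB; rewrite /= sub0r normrN gtr0_norm//; lra.
Qed.

End Norms.

(** * One-variable calculus *)

Section Calculus.
Context {R : realType}.

Lemma nondecreasing_of_derive (f df : R -> R) (a b : R) : a <= b ->
  (forall x, a <= x <= b -> is_derive x 1 f (df x)) ->
  (forall x, a <= x <= b -> 0 <= df x) -> f a <= f b.
Proof.
move=> ab fd df0.
have fd' x : x \in `]a, b[ -> is_derive x 1 f (df x).
  by rewrite in_itv/= => /andP[ax xb]; apply: fd; rewrite !ltW.
have [|c] := MVT_segment ab fd'.
  apply: derivable_within_continuous => x; rewrite in_itv/= => xab.
  by have [] := fd x xab.
rewrite in_itv/= => cab /eqP; rewrite subr_eq => /eqP ->.
by rewrite lerDr mulr_ge0 ?subr_ge0// df0.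
Qed.

Lemma is_derive_exp_lin (c x : R) :
  is_derive x 1 (fun t => expR (c * t)) (c * expR (c * x)).
Proof.
have h : is_derive x 1 (fun t : R => c * t) c.
  have -> : (fun t : R => c * t) = (c \*: (@id R)) by [].
  by apply: is_derive_eq; rewrite /GRing.scale/= mulr1.
by have := @is_derive1_comp R expR (fun t => c * t) x _ _ (is_derive_expR _) h; rewrite mulrC.
Qed.

(** [f x * exp (- c * x)] is nondecreasing. All growth and decay rates below come
    from this differential inequality, applied to squared norms and to quadratic
    cone forms. *)
Lemma exp_growth (f df : R -> R) (a b c : R) : a <= b ->
  (forall x, a <= x <= b -> is_derive x 1 f (df x)) ->
  (forall x, a <= x <= b -> c * f x <= df x) ->
  f a * expR (c * (b - a)) <= f b.
Proof.
move=> ab fd dfc.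
have : f a * expR (- c * a) <= f b * expR (- c * b).
  apply: (@nondecreasing_of_derive (fun x => f x * expR (- c * x))
    (fun x => (df x - c * f x) * expR (- c * x))) => // x xab.
    have h1 := fd x xab; have h2 := is_derive_exp_lin (- c) x.
    apply: is_derive_eq; rewrite /GRing.scale/=; ring.
  by rewrite mulr_ge0 ?expR_ge0// subr_ge0 dfc.
rewrite !mulNr !expRN ler_pdivlMr ?expR_gt0//.
by rewrite mulrBr addrC expRD expRN mulrA.
Qed.

Lemma is_derive_coord n (g : R -> 'cV[R]_n) (t : R) v i :
  is_derive t 1 g v -> is_derive t 1 (fun r : R => g r i 0) (v i 0).
Proof.
move=> [gd gv]; apply: DeriveDef; first by move/derivable_mxP: gd; exact.
by rewrite -gv derive_mx// mxE.
Qed.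

Lemma is_derive_of_coord n (g : R -> 'cV[R]_n) (t : R) (v : 'cV[R]_n) :
  (forall i, is_derive t 1 (fun r : R => g r i 0) (v i 0)) -> is_derive t 1 g v.
Proof.
move=> gv; have gd : derivable g t 1.
  by apply/derivable_mxP => i j; rewrite (ord1 j); have [] := gv i.
apply: DeriveDef => //; rewrite derive_mx//; apply/matrixP => i j.
by rewrite mxE (ord1 j); have [_] := gv i.
Qed.

Lemma is_derive_bigsum n (f df : 'I_n -> R -> R) (t : R) :
  (forall i, is_derive t 1 (f i) (df i t)) ->
  is_derive t 1 (fun r : R => \sum_(i < n) f i r) (\sum_(i < n) df i t).
Proof.
move=> fd; have -> : (fun r : R => \sum_(i < n) f i r) = \sum_(i < n) f i.
  by apply/funext => r; rewrite fct_sumE.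
exact: is_derive_sum.
Qed.

Lemma is_derive_continuous n (g : R -> 'cV[R]_n) (t : R) (v : 'cV[R]_n) :
  is_derive t 1 g v -> {for t, continuous g}.
Proof. by move=> [/derivable1_diffP/differentiable_continuous]. Qed.

Lemma is_derive_reverse (g : R -> R) (t v : R) :
  is_derive (- t) 1 g v -> is_derive t 1 (fun r : R => g (- r)) (- v).
Proof.
move=> h; have := @is_derive1_comp R g -%R t _ _ h (is_deriveNid _ _).
by rewrite mulrN1.
Qed.

(** The base point [-1] lies strictly left of [0], which makes [0] interior to the
    interval on which the integral is differentiable. *)
Lemma antiderivative_right (f : R -> R) : continuous f ->
  exists F : R -> R, F 0 = 0 /\ forall x : R, -1 < x -> is_derive x 1 F (f x).
Proof.
move=> fc; pose I (x : R) : R := (\int[lebesgue_measure]_(t in `[-1, x]) f t)%R.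
have Id (x : R) : -1 < x -> is_derive x 1 I (f x).
  move=> x1; have [] : derivable I x 1 /\ derive1 I x = f x; last first.
    by move=> dI I'; apply: DeriveDef; [exact: dI|rewrite -derive1E].
  apply: (@continuous_FTC1_closed R f (-1) x (x + 1)).
  - by rewrite ltrDl.
  - apply: continuous_compact_integrable; first exact: segment_compact.
    by apply: continuous_subspaceT => ?; exact: fc.
  - exact: x1.
  - exact: fc.
exists (fun x => I x - I 0); split; first by rewrite subrr.
by move=> x /Id Ix; apply: is_derive_eq; rewrite subr0.
Qed.

(** Reversing time in the previous lemma covers [x < 1]. The two primitives vanish
    at [0], so they agree where both are available and glue. *)
Lemma antiderivative (f : R -> R) : continuous f ->
  exists F : R -> R, F 0 = 0 /\ forall x : R, is_derive x 1 F (f x).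
Proof.
move=> fc.
have [F1 [F10 F1d]] := antiderivative_right fc.
have [|F2 [F20 F2d]] := @antiderivative_right (fun x => - f (- x)).
  move=> x; apply: continuousN; apply: continuous_comp; last exact: fc.
  exact: opp_continuous.
pose F2' (x : R) :=  F2 (- x).
have F2'd (x : R) : x < 1 -> is_derive x 1 F2' (f x).
  move=> x1; have := @is_derive_reverse F2 x (- f x).
  by rewrite opprK; apply; have := F2d (- x); rewrite opprK; apply; rewrite ltrN2.
have eqF (x : R) : -1 < x < 1 -> F1 x = F2' x.
  move=> /andP[x1 x2].
  have h (y : R) : -1 < y -> y < 1 -> is_derive y 1 (fun z => F1 z - F2' z) 0.
    move=> y1 y2; have := F1d y y1; have := F2'd y y2 => ? ?.
    by apply: is_derive_eq; rewrite subrr.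
  have h' (y : R) : -1 < y -> y < 1 -> is_derive y 1 (fun z => - (F1 z - F2' z)) 0.
    by move=> y1 y2; have := h y y1 y2 => ?; apply: is_derive_eq; rewrite oppr0.
  have D0 : F1 0 - F2' 0 = 0 by rewrite F10 /F2' oppr0 F20 subrr.
  have cst (y z : R) : -1 < y -> y <= z -> z < 1 -> F1 y - F2' y = F1 z - F2' z.
    move=> y1 yz z1; apply/eqP; rewrite eq_le; apply/andP; split.
      apply: (@nondecreasing_of_derive (fun z => F1 z - F2' z) (fun=> 0)) => //
        w /andP[? ?].
      by apply: h; lra.
    rewrite -lerN2.
    apply: (@nondecreasing_of_derive (fun z => - (F1 z - F2' z)) (fun=> 0)) => //
      w /andP[? ?].
    by apply: h'; lra.
  apply/eqP; rewrite -subr_eq0 -D0; apply/eqP; have [x0|x0] := leP x 0.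
    by apply: cst => //; lra.
  by apply/esym/cst => //; lra.
exists (fun x => if x < 0 then F2' x else F1 x); split; first by rewrite ltxx.
move=> x; have [x0|x0] := ltP x 0.
  apply: (@near_eq_is_derive _ _ _ F2'); last by apply: F2'd; lra.
  by near=> y; rewrite ifT//; near: y; exact: lt_nbhsl.
apply: (@near_eq_is_derive _ _ _ F1); last by apply: F1d; lra.
near=> y; case: ifPn => // y0; apply: eqF; apply/andP; split; last by lra.
by near: y; apply: lt_nbhsr; lra.
Unshelve. all: by end_near. Qed.

Lemma vector_antiderivative n (f : R -> 'cV[R]_n) (p : 'cV[R]_n) : continuous f ->
  exists F : R -> 'cV[R]_n, F 0 = p /\ forall x : R, is_derive x 1 F (f x).
Proof.
move=> fc.
have /choice[F FP] (i : 'I_n) : exists F : R -> R,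
    F 0 = 0 /\ forall x : R, is_derive x 1 F (f x i 0).
  apply: antiderivative => x.
  apply: (@continuous_comp _ _ _ f (fun p : 'cV[R]_n => p i 0)); first exact: fc.
  exact: continuous_coord.
exists (fun x => \col_i (p i 0 + F i x)); split.
  by apply/matrixP => i j; rewrite mxE (ord1 j) (FP i).1 addr0.
move=> x; apply: is_derive_of_coord => i.
under eq_fun do rewrite mxE.
have Fd := (FP i).2 x.
have := is_deriveD (is_derive_cst (p i 0) x 1) Fd.
by rewrite add0r.
Qed.

Lemma exp_bound_scalar (h dh : R -> R) (C l : R) : 0 <= C -> h 0 = 0 ->
  (forall t : R, is_derive t 1 h (dh t)) ->
  (forall t, `|dh t| <= C * l * expR (l * `|t|)) ->
  forall t, h t <= C * expR (l * `|t|).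
Proof.
move=> C0 h0 hd dhb.
have key (k dk : R -> R) : k 0 = 0 -> (forall t : R, is_derive t 1 k (dk t)) ->
    (forall t, `|dk t| <= C * l * expR (l * `|t|)) ->
    forall t : R, 0 <= t -> k t <= C * expR (l * t).
  move=> k0 kd dkb t t0.
  have := @nondecreasing_of_derive (fun s => C * expR (l * s) - k s)
    (fun s => C * (l * expR (l * s)) - dk s) 0 t t0.
  rewrite k0 mulr0 expR0 mulr1 subr0 => H.
  suff : C <= C * expR (l * t) - k t by lra.
  apply: H => x /andP[x0 xt].
    have ? := is_derive_exp_lin l x; have ? := kd x.
    by apply: is_derive_eq; rewrite /GRing.scale/= ?mulr0 ?addr0.
  have := dkb x; rewrite (ger0_norm x0) mulrA subr_ge0; apply: le_trans.
  exact: ler_norm.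
move=> t; have [t0|t0] := leP 0 t.
  by rewrite (ger0_norm t0); exact: key.
rewrite -[in leLHS](opprK t) (ltr0_norm t0).
apply: (key (fun s => h (- s)) (fun s => - dh (- s))) => /=.
- by rewrite oppr0.
- by move=> s; exact: is_derive_reverse.
- by move=> s; rewrite normrN; have := dhb (- s); rewrite normrN.
- by rewrite oppr_ge0 ltW.
Qed.

(** The weight [exp (l * |t|)] is reproduced by integration up to the factor [1 / l].
    This is what makes Picard iteration a contraction on the whole line at once. *)
Lemma exp_bound n (g dg : R -> 'cV[R]_n) (C l : R) : 0 <= C -> g 0 = 0 ->
  (forall t : R, is_derive t 1 g (dg t)) ->
  (forall t, `|dg t| <= C * l * expR (l * `|t|)) ->
  forall t, `|g t| <= C * expR (l * `|t|).
Proof.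
move=> C0 g0 gd dgb t; apply: norm_le_coord.
  by rewrite mulr_ge0 ?expR_ge0.
move=> i; rewrite ler_norml; apply/andP; split.
  rewrite lerNl.
  apply: (@exp_bound_scalar (fun s => - g s i 0) (fun s => - dg s i 0)) => //.
  - by rewrite g0 mxE oppr0.
  - by move=> s; have ? := is_derive_coord i (gd s); apply: is_derive_eq.
  - by move=> s; rewrite normrN (le_trans (coord_le_norm _ _)).
apply: (@exp_bound_scalar (fun s => g s i 0) (fun s => dg s i 0)) => //.
- by rewrite g0 mxE.
- by move=> s; exact: is_derive_coord.
- by move=> s; rewrite (le_trans (coord_le_norm _ _)).
Qed.

End Calculus.

(** * Globally Lipschitz differential equations *)

Definition dotv (R : realType) (k : nat) (x y : 'cV[R]_k) : R :=
  \sum_(i < k) x i 0 * y i 0.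

Definition lipschitz_field (R : realType) (n : nat) (G : 'cV[R]_n -> 'cV[R]_n)
  (K : R) := forall p q, `|G p - G q| <= K * `|p - q|.

Definition integral_curve (R : realType) (n : nat) (G : 'cV[R]_n -> 'cV[R]_n)
  (g : R -> 'cV[R]_n) := forall t : R, is_derive t 1 g (G (g t)).

Section LipschitzODE.
Context {R : realType}.

Lemma half_pow_small (A e : R) : 0 < e -> exists k, A * 2^-1 ^+ k <= e.
Proof.
move=> e0; pose k := Num.bound (`|A| / e).
have kP : `|A| / e < k%:R by apply: archi_boundP; rewrite divr_ge0// ltW.
exists k; rewrite exprVn ler_pdivrMr ?exprn_gt0//.
apply: (le_trans (ler_norm A)); rewrite -ler_pdivrMl// mulrC.
by rewrite (le_trans (ltW kP))// -natrX ler_nat ltnW// ltn_expl.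
Qed.

Lemma cvg_of_geometric n (u : nat -> 'cV[R]_n) (A : R) :
  (forall k, `|u k.+1 - u k| <= A * 2^-1 ^+ k) ->
  exists l, forall k, `|l - u k| <= 2 * A * 2^-1 ^+ k.
Proof.
move=> du.
have A0 : 0 <= A by have := du 0%N; rewrite expr0 mulr1; exact: le_trans.
have duS k m : `|u (k + m)%N - u k| <= 2 * A * 2^-1 ^+ k - 2 * A * 2^-1 ^+ (k + m).
  elim: m => [|m ih]; first by rewrite addn0 !subrr normr0.
  rewrite addnS -(subrKA (u (k + m)%N)); apply: (le_trans (ler_normD _ _)).
  have := du (k + m)%N; rewrite exprS; move: ih; lra.
have uA k m : (k <= m)%N -> `|u m - u k| <= 2 * A * 2^-1 ^+ k.
  move=> km; have := duS k (m - k)%N; rewrite subnKC// => /le_trans; apply.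
  by rewrite gerBl mulr_ge0 ?exprn_ge0// mulr_ge0.
have : cvg (u @ \oo).
  apply/cauchy_cvgP/cauchy_exP => e e0.
  have [k kA] := half_pow_small (2 * A) (divr_gt0 e0 (ltr0n _ 2)).
  exists (u k); exists k => //= m km; rewrite -ball_normE/= distrC.
  apply: (@le_lt_trans _ _ (e / 2)); last by rewrite ltr_pdivrMr// ltr_pMr// ltr1n.
  by apply: le_trans kA; exact: uA.
move=> ul; exists (lim (u @ \oo)) => k; apply/ler_addgt0Pr => e e0.
move/cvgrPdist_le : ul => /(_ e e0) [N _ Ne].
have := Ne (maxn N k) (leq_maxl _ _) => h1.
have h2 := uA k (maxn N k) (leq_maxr _ _).
rewrite -(subrKA (u (maxn N k))) addrC.
by rewrite (le_trans (ler_normD _ _))// lerD.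
Qed.

Lemma lipschitz_continuous (V W : normedModType R) (G : V -> W) (K : R) : 0 < K ->
  (forall p q, `|G p - G q| <= K * `|p - q|) -> continuous G.
Proof.
move=> K0 GK x; apply/cvgrPdist_le => e e0.
near=> y; apply: le_trans (GK _ _) _; rewrite -ler_pdivlMl//.
by near: y; apply: cvgr_dist_le; [exact: cvg_id|rewrite mulr_gt0 ?invr_gt0].
Unshelve. all: by end_near. Qed.

(** Picard iteration contracts by [1/2] in the weighted norm
    [sup_t |g t| * exp (- 2 * K * |t|)], so that the iterates converge, locally
    uniformly in time, to a solution defined for all times. *)
Lemma picard n (G : 'cV[R]_n -> 'cV[R]_n) (K : R) (p : 'cV[R]_n) : 0 < K ->
  lipschitz_field G K -> exists2 g, g 0 = p & integral_curve G g.
Proof.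
move=> K0 GK; pose l := 2 * K; have l0 : 0 < l by rewrite mulr_gt0.
have Gc : continuous G by exact: (lipschitz_continuous K0).
have /choice[T TP] (f : R -> 'cV[R]_n) : exists F : R -> 'cV[R]_n, continuous f ->
    F 0 = p /\ forall x : R, is_derive x 1 F (G (f x)).
  have [fc|nfc] := pselect (continuous f); last by exists f => /nfc.
  have [|F FP] := @vector_antiderivative R n (G \o f) p; last by exists F.
  by move=> x; apply: continuous_comp; [exact: fc|exact: Gc].
pose u k := iter k T (cst p).
have uc k : continuous (u k).
  elim: k => [|k ih] x; first exact: cst_continuous.
  exact: (is_derive_continuous ((TP _ ih).2 x)).
have u0 k : u k 0 = p by case: k => [//|k]; exact: (TP _ (uc k)).1.
have ud k (x : R) : is_derive x 1 (u k.+1) (G (u k x)) by exact: (TP _ (uc k)).2.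
(* the first increment, [t |-> t *: G p], is at most [C * exp (l * |t|)] *)
pose C := `|G p| / l.
have C0 : 0 <= C by rewrite divr_ge0// ltW.
have h0 k : (0 : R) <= 2^-1 ^+ k by rewrite exprn_ge0.
have du k t : `|u k.+1 t - u k t| <= C * 2^-1 ^+ k * expR (l * `|t|).
  elim: k t => [|k ih].
    apply: (@exp_bound R n (fun t => u 1%N t - u 0%N t) (fun t => G p)).
    - by rewrite expr0 mulr1.
    - by rewrite !u0 subrr.
    - move=> t; have h1 := ud 0%N t.
      have := is_deriveB h1 (is_derive_cst p t 1).
      by rewrite subr0.
    - move=> t; rewrite expr0 mulr1 /C divfK ?gt_eqF//.
      by rewrite ler_peMr// -expR0 ler_expR mulr_ge0// ltW.
  apply: (@exp_bound R n (fun t => u k.+2 t - u k.+1 t)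
    (fun t => G (u k.+1 t) - G (u k t))).
  - by rewrite mulr_ge0.
  - by rewrite !u0 subrr.
  - move=> t; apply: le_trans (GK _ _) _.
    rewrite (_ : C * _ * _ * _ = K * (C * 2^-1 ^+ k * expR (l * `|t|))).
      by rewrite ler_pM2l.
    by rewrite exprS /l; field.
have /choice[g gP] t :
    exists y, forall k, `|y - u k t| <= 2 * C * expR (l * `|t|) * 2^-1 ^+ k.
  have [k|x xP] := @cvg_of_geometric n (fun k => u k t) (C * expR (l * `|t|)).
    by rewrite mulrAC; exact: du.
  by exists x => k; have := xP k; rewrite mulrA.
have gc : continuous g.
  move=> t; apply/cvgrPdist_le => e e0.
  have [k kP] := half_pow_small (2 * C * expR (l * (`|t| + 1))) (divr_gt0 e0 (ltr0n _ 3)).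
  have gk s : `|s| <= `|t| + 1 -> `|g s - u k s| <= e / 3.
    move=> st; apply: le_trans (gP s k) _; apply: le_trans kP.
    apply: ler_wpM2r => //; apply: ler_wpM2l; first by rewrite mulr_ge0.
    by rewrite ler_expR ler_pM2l.
  near=> s.
  have st : `|s| <= `|t| + 1.
    rewrite -(subrK t s) (le_trans (ler_normD _ _))// addrC lerD2l distrC.
    by near: s; apply: cvgr_dist_le => //; exact: cvg_id.
  have h1 := gk s st; have h2 : `|g t - u k t| <= e / 3 by apply: gk; rewrite lerDl.
  have h3 : `|u k t - u k s| <= e / 3.
    by near: s; apply: cvgr_dist_le; [exact: uc|rewrite divr_gt0].
  rewrite (_ : g t - g s = (g t - u k t) + (u k t - u k s) - (g s - u k s)); last first.
    by apply/matrixP => i j; rewrite !mxE; ring.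
  apply: (le_trans (ler_normB _ _)); have := ler_normD (g t - u k t) (u k t - u k s).
  lra.
have [Tg0 Tgd] := TP g gc.
have Tgk t k : `|T g t - u k.+1 t| <= C * 2^-1 ^+ k * expR (l * `|t|).
  apply: (@exp_bound R n (fun t => T g t - u k.+1 t) (fun t => G (g t) - G (u k t))).
  - by rewrite mulr_ge0.
  - by rewrite u0 Tg0 subrr.
  - move=> s; apply: le_trans (GK _ _) _.
    rewrite (_ : C * _ * _ * _ = K * (2 * C * expR (l * `|s|) * 2^-1 ^+ k)).
      by rewrite ler_pM2l.
    by rewrite /l; ring.
(* both are within [O (2^-k)] of the iterate [u k.+1] *)
have Tgg : T g = g.
  apply/funext => t; apply/eqP; rewrite -subr_eq0 -normr_le0; apply/ler_addgt0Pr => e e0.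
  rewrite add0r.
  have [k kP] := half_pow_small (2 * C * expR (l * `|t|)) e0.
  apply: le_trans kP.
  rewrite -(subrKA (u k.+1 t)); apply: (le_trans (ler_normD _ _)).
  have h1 := Tgk t k; have := gP t k.+1; rewrite distrC exprS => h2.
  by apply: le_trans (lerD h1 h2) _; rewrite le_eqVlt; apply/orP; left; apply/eqP; field.
exists g; first by rewrite -Tgg.
by move=> t; rewrite -[in X in is_derive _ _ X]Tgg.
Unshelve. all: by end_near. Qed.

Lemma is_derive_sqn n (d : R -> 'cV[R]_n) (t : R) (v : 'cV[R]_n) :
  is_derive t 1 d v -> is_derive t 1 (fun s : R => sqn (d s)) (2 * dotv (d t) v).
Proof.
move=> dv; rewrite /dotv mulr_sumr.
apply: (@is_derive_bigsum R n (fun i (s : R) => d s i 0 ^+ 2)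
  (fun i s => 2 * (d s i 0 * v i 0))) => i.
have h := is_derive_coord i dv; under eq_fun do rewrite expr2.
have := is_deriveM h h; rewrite /GRing.scale/= => h'.
by apply: is_derive_eq; ring.
Qed.

Lemma dotv_le n (x y : 'cV[R]_n) : `|dotv x y| <= n%:R * (`|x| * `|y|).
Proof.
have -> : n%:R * (`|x| * `|y|) = \sum_(i < n) (`|x| * `|y|).
  by rewrite sumr_const card_ord mulr_natl.
apply: (le_trans (ler_norm_sum _ _ _)); apply: ler_sum => i _.
by rewrite normrM ler_pM// coord_le_norm.
Qed.

(** The squared Euclidean distance [E] satisfies [|E'| <= 2 * n * K * E]; the factor
    [n] is the price of measuring the Lipschitz constant in the sup norm. *)
Lemma gronwall n (G : 'cV[R]_n -> 'cV[R]_n) (K : R) (g1 g2 : R -> 'cV[R]_n) (a b : R) :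
  0 <= K -> lipschitz_field G K -> a <= b ->
  (forall x : R, a <= x <= b -> is_derive x 1 g1 (G (g1 x))) ->
  (forall x : R, a <= x <= b -> is_derive x 1 g2 (G (g2 x))) ->
  sqn (g1 b - g2 b) <= sqn (g1 a - g2 a) * expR (2 * n%:R * K * (b - a)) /\
  sqn (g1 a - g2 a) <= sqn (g1 b - g2 b) * expR (2 * n%:R * K * (b - a)).
Proof.
move=> K0 GK ab d1 d2; set c := 2 * n%:R * K.
have E' (x : R) : a <= x <= b -> is_derive x 1 (fun s : R => sqn (g1 s - g2 s))
    (2 * dotv (g1 x - g2 x) (G (g1 x) - G (g2 x))).
  move=> xab; apply: (@is_derive_sqn n (fun s => g1 s - g2 s)).
  exact: is_deriveB (d1 x xab) (d2 x xab).
have bnd x : `|2 * dotv (g1 x - g2 x) (G (g1 x) - G (g2 x))| <= c * sqn (g1 x - g2 x).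
  rewrite normrM (ger0_norm (ler0n _ 2)) /c -!mulrA ler_pM2l//.
  apply: le_trans (dotv_le _ _) _; rewrite ler_wpM2l//.
  apply: (@le_trans _ _ (K * `|g1 x - g2 x| ^+ 2)).
    by rewrite expr2 mulrCA ler_wpM2l.
  by rewrite ler_wpM2l// normsq_le_sqn.
split.
  have := @exp_growth R (fun s => - sqn (g1 s - g2 s)) _ a b c ab
    (fun x xab => is_deriveN (E' x xab)) _.
  rewrite mulNr lerN2; apply => x xab; rewrite mulrN lerN2.
  exact: le_trans (ler_norm _) (bnd x).
have := @exp_growth R (fun s => sqn (g1 s - g2 s)) _ a b (- c) ab E' _.
rewrite mulNr expRN ler_pdivrMr ?expR_gt0//; apply => x xab.
by rewrite mulNr lerNl; apply: le_trans (bnd x); rewrite -normrN ler_norm.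
Qed.

Lemma integral_curve_unique n (G : 'cV[R]_n -> 'cV[R]_n) (K : R) (g1 g2 : R -> 'cV[R]_n)
    (a b t0 : R) : 0 <= K -> lipschitz_field G K ->
  (forall x : R, a <= x <= b -> is_derive x 1 g1 (G (g1 x))) ->
  (forall x : R, a <= x <= b -> is_derive x 1 g2 (G (g2 x))) ->
  a <= t0 <= b -> g1 t0 = g2 t0 -> forall t, a <= t <= b -> g1 t = g2 t.
Proof.
move=> K0 GK d1 d2 /andP[at0 t0b] e t /andP[at_ tb].
apply/eqP; rewrite -subr_eq0; apply/eqP/sqn_eq0.
have [tt0|tt0] := leP t t0.
  have [||_] := @gronwall n G K g1 g2 t t0 K0 GK tt0.
  - by move=> x /andP[? ?]; apply: d1; lra.
  - by move=> x /andP[? ?]; apply: d2; lra.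
  by rewrite e subrr sqn0 mul0r.
have [||+ _] := @gronwall n G K g1 g2 t0 t K0 GK (ltW tt0).
- by move=> x /andP[? ?]; apply: d1; lra.
- by move=> x /andP[? ?]; apply: d2; lra.
by rewrite e subrr sqn0 mul0r.
Qed.

Lemma integral_curve_shift n (G : 'cV[R]_n -> 'cV[R]_n) (g : R -> 'cV[R]_n) (h : R) :
  integral_curve G g -> integral_curve G (fun t => g (t + h)).
Proof.
move=> gG t; apply: is_derive_of_coord => i.
have h1 := is_derive_coord i (gG (t + h)).
have h2 := is_derive_shift t 1 h.
by have := @is_derive1_comp R (fun s => g s i 0) (fun s => s + h) t _ _ h1 h2; rewrite mulr1.
Qed.

End LipschitzODE.

(** * Extension of a vector field with entrywise derivative bounds *)

Definition in_box (R : realType) (m n : nat) (lo hi A : 'M[R]_(m, n)) :=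
  forall i j, lo i j <= A i j <= hi i j.

Definition segment_convex (R : realType) (n : nat) (K : set 'cV[R]_n) :=
  forall p q t, K p -> K q -> 0 <= t <= 1 -> K (q + t *: (p - q)).

(** The support function of a nonempty box of matrices: [box_gauge lo hi i z] is the
    largest value of [(A *m z) i 0] for [A] in the box. It plays the role of the
    distance in the extension below, and is subadditive but not symmetric. *)
Definition box_gauge (R : realType) (m n : nat) (lo hi : 'M[R]_(m, n)) i (z : 'cV[R]_n) : R :=
  \sum_j Num.max (hi i j * z j 0) (lo i j * z j 0).

Section Extension.
Context {R : realType}.

Lemma derive_Dmx n (F : 'cV[R]_n -> 'cV[R]_n) (x v : 'cV[R]_n) :
  differentiable F x -> 'D_v F x = Dmx F x *m v.
Proof.
move=> Fx; rewrite deriveE//.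
have -> : v = \sum_j v j 0 *: delta_mx j 0.
  apply/matrixP => i j; rewrite (ord1 j) summxE (bigD1 i)//= !mxE !eqxx mulr1.
  by rewrite big1 ?addr0// => k ki; rewrite !mxE eq_sym (negbTE ki) mulr0.
rewrite linear_sum mulmx_sumr/=; apply: eq_bigr => j _.
rewrite linearZ -scalemxAr -deriveE//; congr (_ *: _).
by apply/matrixP => i k; rewrite (ord1 k) -colE !mxE.
Qed.

Lemma is_derive_line n (F : 'cV[R]_n -> 'cV[R]_n) (q v : 'cV[R]_n) (t : R) :
  differentiable F (q + t *: v) ->
  is_derive t 1 (fun s : R => F (q + s *: v)) (Dmx F (q + t *: v) *m v).
Proof.
move=> Fx; have d1 : derivable F (q + t *: v) v by exact: diff_derivable.
have E : (fun h : R => h^-1 *: ((F \o shift (q + t *: v)) (h *: v) - F (q + t *: v)))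
   = (fun h : R => h^-1 *: (((fun s : R => F (q + s *: v)) \o shift t) (h *: 1) - F (q + t *: v))).
  apply/funext => h /=; congr (_ *: (F _ - _)).
  by rewrite scalerDl /GRing.scale/= mulr1 addrCA.
apply: DeriveDef; first by rewrite /derivable -E.
rewrite -(derive_Dmx v Fx).
by apply: (congr1 (fun f : R -> 'cV[R]_n => lim (f h @[h --> 0^']))); exact/esym.
Qed.

(** The intermediate point [c] depends on the row [i]. Hence the difference of two
    values of [F] is the image of [p - q] under a matrix that need not be any
    [Dmx F c], but whose entries lie between the bounds on those of [Dmx F]. *)
Lemma mean_value n (F : 'cV[R]_n -> 'cV[R]_n) (K : set 'cV[R]_n) (p q : 'cV[R]_n) i :
  segment_convex K -> (forall x, K x -> differentiable F x) -> K p -> K q ->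
  exists2 c, K c & F p i 0 - F q i 0 = \sum_j Dmx F c i j * (p - q) j 0.
Proof.
move=> Kc Fd Kp Kq.
have d (t : R) : 0 <= t <= 1 -> is_derive t 1 (fun s : R => F (q + s *: (p - q)) i 0)
    ((Dmx F (q + t *: (p - q)) *m (p - q)) i 0).
  move=> t01; apply: (@is_derive_coord R n (fun s : R => F (q + s *: (p - q)))).
  by apply: is_derive_line; apply: Fd; exact: Kc.
have d' (t : R) : t \in `]0, 1[ -> is_derive t 1 (fun s : R => F (q + s *: (p - q)) i 0)
    ((Dmx F (q + t *: (p - q)) *m (p - q)) i 0).
  by rewrite in_itv/= => /andP[? ?]; apply: d; rewrite !ltW.
have [|t] := MVT_segment ler01 d'.
  apply: derivable_within_continuous => x; rewrite in_itv/= => xab.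
  by have [] := d x xab.
have E : q + (p - q) = p by rewrite addrC subrK.
rewrite in_itv/= => t01; rewrite scale1r scale0r addr0 E subr0 mulr1 => ->.
exists (q + t *: (p - q)); first exact: Kc.
by rewrite mxE.
Qed.

Lemma mxcoord_le_norm m n (A : 'M[R]_(m, n)) i j : `|A i j| <= `|A|.
Proof.
rewrite [leRHS]/Num.norm/= mx_normrE; exact: (le_bigmax _ (fun ij => `|A ij.1 ij.2|) (i, j)).
Qed.

Section Gauge.
Variables (m n : nat) (lo hi : 'M[R]_(m, n)).
Hypothesis lohi : forall i j, lo i j <= hi i j.
Local Notation gauge := (box_gauge lo hi).

Lemma box_gauge0 i : gauge i 0 = 0.
Proof. by rewrite /box_gauge big1// => j _; rewrite mxE !mulr0 maxxx. Qed.

Lemma box_gauge_subadd i z w : gauge i (z + w) <= gauge i z + gauge i w.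
Proof.
rewrite /box_gauge -big_split/=; apply: ler_sum => j _; rewrite !mxE !mulrDr.
by rewrite ge_max !lerD// le_max lexx ?orbT.
Qed.

Lemma box_gauge_ge (A : 'M[R]_(m, n)) i (z : 'cV[R]_n) : in_box lo hi A ->
  \sum_j A i j * z j 0 <= gauge i z.
Proof.
move=> bA; apply: ler_sum => j _; have /andP[h1 h2] := bA i j.
rewrite le_max; have [z0|z0] := leP 0 (z j 0).
  by rewrite ler_wpM2r.
by apply/orP; right; rewrite ler_wnM2r// ltW.
Qed.

(** In each row the extreme values are attained at two vertices of the box, chosen
    by the signs of the coordinates of [z]; the wanted value is attained on the
    segment that joins them. *)
Lemma box_gauge_attained (z : 'cV[R]_n) (v : 'cV[R]_m) :
  (forall i, - gauge i (- z) <= v i 0 <= gauge i z) ->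
  exists2 A, in_box lo hi A & v = A *m z.
Proof.
move=> vz; pose M i := gauge i z; pose mm i := - gauge i (- z).
(* [th i] locates [v i 0] between the extreme values; it is arbitrary if they
   coincide *)
pose th i := if M i == mm i then 0 else (v i 0 - mm i) / (M i - mm i).
pose top i j := if 0 <= z j 0 then hi i j else lo i j.
pose bot i j := if 0 <= z j 0 then lo i j else hi i j.
have topE i : \sum_j top i j * z j 0 = M i.
  apply: eq_bigr => j _; rewrite /top; have [z0|z0] := leP 0 (z j 0).
    by rewrite max_l// ler_wpM2r.
  by rewrite max_r// ler_wnM2r// ltW.
have botE i : \sum_j bot i j * z j 0 = mm i.
  rewrite /mm /box_gauge -sumrN; apply: eq_bigr => j _; rewrite /bot mxE.
  have [z0|z0] := leP 0 (z j 0).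
    by rewrite max_r ?mulrN ?opprK// lerN2 ler_wpM2r.
  by rewrite max_l ?mulrN ?opprK// lerN2 ler_wnM2r// ltW.
have th01 i : 0 <= th i <= 1.
  rewrite /th; case: eqP => [|/eqP MM]; first by rewrite lexx ler01.
  have /andP[h1 h2] := vz i.
  have h3 : 0 < M i - mm i by rewrite lt_neqAle eq_sym subr_eq0 MM subr_ge0 (le_trans h1).
  rewrite divr_ge0 ?subr_ge0 ?(ltW h3)//= ?(le_trans h1)//.
  by rewrite ler_pdivrMr// mul1r lerD2r.
exists (\matrix_(i, j) ((1 - th i) * bot i j + th i * top i j)).
  move=> i j; rewrite mxE; have := lohi i j; have /andP[h1 h2] := th01 i.
  by rewrite /bot /top; case: ifP => _ h; apply/andP; split; nra.
apply/matrixP => i k; rewrite (ord1 k) mxE.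
under eq_bigr do rewrite mxE mulrDl -!mulrA.
rewrite big_split/= -!mulr_sumr topE botE /th.
have /andP[h1 h2] := vz i; case: eqP => [MM|/eqP MM].
  by rewrite subr0 mul1r mul0r addr0; apply/eqP; rewrite eq_le h1 andbT /mm -/(mm i) -MM.
by field; rewrite subr_eq0.
Qed.

End Gauge.

(** McShane's formula [inf_q (F q + gauge (p - q))], taken coordinate by coordinate.
    Because the distance is replaced by the support function of the box, the
    extension keeps every entrywise bound on difference quotients, and not only
    a Lipschitz constant. *)
Lemma mcshane_extension n (lo hi : 'M[R]_n) (K : set 'cV[R]_n) (F : 'cV[R]_n -> 'cV[R]_n) :
  (forall i j, lo i j <= hi i j) -> K !=set0 ->
  (forall p q i, K p -> K q -> F p i 0 - F q i 0 <= box_gauge lo hi i (p - q)) ->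
  exists2 G : 'cV[R]_n -> 'cV[R]_n, (forall p, K p -> G p = F p) &
    forall p q, exists2 A, in_box lo hi A & G p - G q = A *m (p - q).
Proof.
move=> lohi [q0 Kq0] FK.
pose S i p := [set F q i 0 + box_gauge lo hi i (p - q) | q in K].
pose G p := \col_i inf (S i p).
(* the infimum is finite by subadditivity along [q0 - q = (q0 - p) + (p - q)] *)
have lbS i p q : K q ->
    F q0 i 0 - box_gauge lo hi i (q0 - p) <= F q i 0 + box_gauge lo hi i (p - q).
  move=> Kq; have h1 := FK q0 q i Kq0 Kq.
  have := box_gauge_subadd lo hi i (q0 - p) (p - q); rewrite addrA subrK; lra.
have Sinf i p : has_inf (S i p).
  split; first by exists (F q0 i 0 + box_gauge lo hi i (p - q0)), q0.
  by exists (F q0 i 0 - box_gauge lo hi i (q0 - p)) => _ [q Kq <-]; exact: lbS.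
have Sle i p q : K q -> inf (S i p) <= F q i 0 + box_gauge lo hi i (p - q).
  by move=> Kq; apply: ge_inf; [exact: (Sinf i p).2|exists q].
have SG i p z : (forall q, K q -> z <= F q i 0 + box_gauge lo hi i (p - q)) -> z <= inf (S i p).
  move=> h; apply: lb_le_inf; first exact: (Sinf i p).1.
  by move=> _ [q Kq <-]; exact: h.
have GG i p p' : inf (S i p) - inf (S i p') <= box_gauge lo hi i (p - p').
  rewrite lerBlDl -lerBlDr; apply: SG => q Kq.
  have := Sle i p q Kq; have := box_gauge_subadd lo hi i (p - p') (p' - q).
  by rewrite addrA subrK; lra.
exists G.
  move=> p Kp; apply/matrixP => i k; rewrite (ord1 k) mxE.
  apply/eqP; rewrite eq_le; apply/andP; split.
    by have := Sle i p p Kp; rewrite subrr box_gauge0 addr0.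
  by apply: SG => q Kq; have := FK p q i Kp Kq; lra.
move=> p q; apply: box_gauge_attained => // i; rewrite !mxE GG andbT opprB.
have := GG i q p; lra.
Qed.

Lemma mulmx_norm_le m n (A : 'M[R]_(m, n)) (x : 'cV[R]_n) :
  `|A *m x| <= n%:R * `|A| * `|x|.
Proof.
apply: norm_le_coord; first by rewrite !mulr_ge0.
move=> i; rewrite mxE.
have -> : n%:R * `|A| * `|x| = \sum_(i < n) (`|A| * `|x|).
  by rewrite sumr_const card_ord -mulrA mulr_natl.
apply: (le_trans (ler_norm_sum _ _ _)); apply: ler_sum => j _.
by rewrite normrM ler_pM// ?coord_le_norm// mxcoord_le_norm.
Qed.

Lemma in_box_lipschitz n (lo hi : 'M[R]_n) (G : 'cV[R]_n -> 'cV[R]_n) :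
  (forall p q, exists2 A, in_box lo hi A & G p - G q = A *m (p - q)) ->
  exists2 K : R, 0 < K & lipschitz_field G K.
Proof.
move=> Gbox; pose C := `|lo| + `|hi|; have C0 : 0 <= C by rewrite addr_ge0.
exists (n%:R * C + 1); first by rewrite ltr_wpDl// mulr_ge0.
move=> p q; have [A bA ->] := Gbox p q.
apply: (le_trans (mulmx_norm_le _ _)); rewrite ler_wpM2r//.
rewrite ler_wpDr// ler_wpM2l//.
rewrite [leLHS]/Num.norm/= mx_normrE; apply: bigmax_le => //= -[i j] _ /=.
have := mxcoord_le_norm lo i j; have := mxcoord_le_norm hi i j.
rewrite !ler_norml => /andP[? ?] /andP[? ?]; have /andP[? ?] := bA i j.
have := normr_ge0 lo; have := normr_ge0 hi.
by rewrite /C => ? ?; apply/andP; split; lra.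
Qed.

Lemma field_extension n (lo hi : 'M[R]_n) (K : set 'cV[R]_n) (F : 'cV[R]_n -> 'cV[R]_n) :
  K !=set0 -> segment_convex K ->
  (forall x, K x -> differentiable F x) -> (forall x, K x -> in_box lo hi (Dmx F x)) ->
  exists2 G : 'cV[R]_n -> 'cV[R]_n, (forall p, K p -> G p = F p) &
    forall p q, exists2 A, in_box lo hi A & G p - G q = A *m (p - q).
Proof.
move=> [q0 Kq0] Kc Fd Fb; apply: mcshane_extension.
- by move=> i j; have /andP[] := Fb _ Kq0 i j; exact: le_trans.
- by exists q0.
- move=> p q i Kp Kq; have [c Kcc ->] := mean_value i Kc Fd Kp Kq.
  exact: box_gauge_ge (Fb _ Kcc).
Qed.

End Extension.

(** * Solutions in an open domain *)

Section OmSolutions.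
Context {R : realType}.

Lemma continuous_ball (V W : normedModType R) (f : V -> W) (x : V) (e : R) :
  {for x, continuous f} -> 0 < e ->
  exists2 d : R, 0 < d & forall y, `|y - x| <= d -> `|f y - f x| <= e.
Proof.
move=> fx e0; have := (@cvgrPdist_le _ _ _ (nbhs x) _ f (f x)).1 fx e e0 => /(_ (nbhs_filter x)).
move=> /nbhs_normP[d /= d0 dP]; exists (d / 2); first by rewrite divr_gt0.
move=> y yx; rewrite distrC; apply: dP => /=; rewrite distrC.
by apply: (le_lt_trans yx); rewrite ltr_pdivrMr// ltr_pMr// ltr1n.
Qed.

Lemma open_ball (V : normedModType R) (A : set V) (x : V) : open A -> A x ->
  exists2 d : R, 0 < d & forall y, `|y - x| <= d -> A y.
Proof.
move=> oA Ax; have : nbhs x A by exact: open_nbhs_nbhs.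
move=> /nbhs_normP[d /= d0 dP]; exists (d / 2); first by rewrite divr_gt0.
move=> y yx; apply: dP => /=; rewrite distrC.
by apply: (le_lt_trans yx); rewrite ltr_pdivrMr// ltr_pMr// ltr1n.
Qed.

(** Near [0] the difference quotient of the glued curve is always one of the two
    given difference quotients, which have the same limit. *)
Lemma glue_derive (V : normedModType R) (f1 f2 : R -> V) (w : V) : f1 0 = f2 0 ->
  is_derive (0 : R) 1 f1 w -> is_derive (0 : R) 1 f2 w ->
  is_derive (0 : R) 1 (fun t : R => if t <= 0 then f1 t else f2 t) w.
Proof.
move=> e [c1 v1] [c2 v2]; set f := (fun t : R => _).
have c : h^-1 *: ((f \o shift 0) (h *: 1) - f 0) @[h --> 0^'] --> w.
  apply/cvgrPdist_le => eps eps0.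
  have h1 : h^-1 *: ((f1 \o shift 0) (h *: 1) - f1 0) @[h --> 0^'] --> w by rewrite -v1.
  have h2 : h^-1 *: ((f2 \o shift 0) (h *: 1) - f2 0) @[h --> 0^'] --> w by rewrite -v2.
  move/cvgrPdist_le : h1 => /(_ eps eps0) h1.
  move/cvgrPdist_le : h2 => /(_ eps eps0) h2.
  near=> h.
  have k1 : `|w - h^-1 *: ((f1 \o shift 0) (h *: 1) - f1 0)| <= eps by near: h.
  have k2 : `|w - h^-1 *: ((f2 \o shift 0) (h *: 1) - f2 0)| <= eps by near: h.
  by rewrite /f /= lexx; case: ifPn => _; [exact: k1|rewrite e; exact: k2].
by apply: DeriveDef; [apply/cvg_ex; exists w|exact: cvg_lim c].
Unshelve. all: by end_near. Qed.

Section OpenDomain.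
Variables (n : nat) (Om : set 'cV[R]_n) (F : 'cV[R]_n -> 'cV[R]_n).
Hypotheses (hOm : open Om) (hF : C1_on Om F).

Definition sol_on (a b : R) (g : R -> 'cV[R]_n) :=
  forall r : R, a < r < b -> Om (g r) /\ is_derive r 1 g (F (g r)).

(** Near [p] the entries of [Dmx F] stay within [1] of their values at [p]. *)
Lemma local_extension (p : 'cV[R]_n) : Om p ->
  exists (G : 'cV[R]_n -> 'cV[R]_n) (e K : R),
    [/\ 0 < e, 0 < K, lipschitz_field G K &
        forall x, `|x - p| <= e -> Om x /\ G x = F x].
Proof.
move=> Op; have [_ Dc] := hF Op.
have [d1 d10 d1P] := continuous_ball Dc ltr01.
have [d2 d20 d2P] := open_ball hOm Op.
pose e := Num.min d1 d2; have e0 : 0 < e by rewrite lt_min d10.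
pose B := [set x : 'cV[R]_n | `|x - p| <= e].
have BOm x : B x -> Om x.
  by move=> Bx; apply: d2P; rewrite (le_trans Bx)// ge_min lexx orbT.
have [||||G GF Gbox] :=
  @field_extension R n (Dmx F p - const_mx 1) (Dmx F p + const_mx 1) B F.
- by exists p; rewrite /B/= subrr normr0 ltW.
- move=> x y t Bx By /andP[t0 t1]; rewrite /B/=.
  rewrite (_ : _ - p = (1 - t) *: (y - p) + t *: (x - p)); last first.
    by apply/matrixP => i j; rewrite !mxE; ring.
  apply: (le_trans (ler_normD _ _)); rewrite !normrZ (ger0_norm t0) ger0_norm ?subr_ge0//.
  have -> : e = (1 - t) * e + t * e by ring.
  by rewrite lerD// ler_wpM2l// subr_ge0.
- by move=> x /BOm Ox; have [] := hF Ox.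
- move=> x Bx i j.
  have : `|Dmx F x - Dmx F p| <= 1 by apply: d1P; rewrite (le_trans Bx)// ge_min lexx.
  move: (Dmx F x) (Dmx F p) => A D /(le_trans (mxcoord_le_norm _ i j)).
  rewrite !mxE ler_norml; move: (A i j) (D i j) => y z /andP[? ?].
  by apply/andP; split; lra.
have [K K0 GK] := in_box_lipschitz Gbox.
by exists G, e, K; split => // x Bx; split; [exact: BOm|exact: GF].
Qed.

(** The set of times at which the solutions agree is closed by continuity, and open
    because near such a time both solve one globally Lipschitz equation; the
    interval is connected. *)
Lemma sol_unique (a b : R) (g1 g2 : R -> 'cV[R]_n) : a < 0 < b ->
  sol_on a b g1 -> sol_on a b g2 -> g1 0 = g2 0 ->
  forall t, a < t < b -> g1 t = g2 t.
Proof.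
move=> ab s1 s2 e12 t tab.
have gc (g : R -> 'cV[R]_n) r : sol_on a b g -> a < r < b -> {for r, continuous g}.
  by move=> s rab; have [_ /is_derive_continuous] := s r rab.
pose A : set R := [set` `]a, b[]; pose B := [set r | a < r < b /\ g1 r = g2 r].
suff BA : B = A.
  by have : A t by [rewrite /A/= in_itv/=]; rewrite -BA => -[].
have cA : connected A by apply/connected_intervalP; exact: interval_is_interval.
apply: cA.
- by exists 0.
- exists B; last by apply/seteqP; split => r /=; rewrite /A/= in_itv/= => -[].
  rewrite openE => r [rab er].
  have [Op _] := s1 r rab.
  have [G [e [K [e0 K0 GK GF]]]] := local_extension Op.
  have [d1 d10 d1P] := continuous_ball (gc g1 r s1 rab) e0.
  have [d2 d20 d2P] := continuous_ball (gc g2 r s2 rab) e0.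
  pose d3 := Num.min (r - a) (b - r) / 2; have /andP[ar rb] := rab.
  have d30 : 0 < d3 by rewrite divr_gt0// lt_min !subr_gt0 ar.
  have d3a : d3 * 2 <= r - a by rewrite /d3 divfK// ge_min lexx.
  have d3b : d3 * 2 <= b - r by rewrite /d3 divfK// ge_min lexx orbT.
  have d3P s : `|s - r| <= d3 -> a < s < b.
    by rewrite ler_norml => /andP[? ?]; apply/andP; split; lra.
  pose d := Num.min d1 (Num.min d2 d3).
  have d0 : 0 < d by rewrite !lt_min d10 d20.
  apply/nbhs_normP; exists d => //= s; rewrite /ball_/= distrC => /ltW sd.
  have k s' : `|s' - r| <= d -> [/\ a < s' < b,
      is_derive s' 1 g1 (G (g1 s')) & is_derive s' 1 g2 (G (g2 s'))].
    rewrite !le_min => /andP[k1 /andP[k2 k3]].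
    have s'ab := d3P s' k3.
    have [_ h1] := s1 s' s'ab; have [_ h2] := s2 s' s'ab.
    by split => //; rewrite (GF _ _).2//; [exact: d1P|rewrite er; exact: d2P].
  have kk s' : r - d <= s' <= r + d -> `|s' - r| <= d.
    by move=> /andP[? ?]; rewrite ler_norml; apply/andP; split; lra.
  split; first by have [] := k s sd.
  apply: (@integral_curve_unique R n G K g1 g2 (r - d) (r + d) r) => //; first exact: ltW.
  - by move=> s' /kk /k[].
  - by move=> s' /kk /k[].
  - by apply/andP; split; lra.
  - by move: sd; rewrite ler_norml => /andP[? ?]; apply/andP; split; lra.
- exists (closure B); first exact: closed_closure.
  apply/seteqP; split => r.
    by move=> Br; split; [rewrite /A/= in_itv/=; exact: Br.1|exact: subset_closure].
  rewrite /A/= in_itv/= => -[rab clB]; split => //.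
  apply/eqP/negPn/negP => /eqP ne.
  pose e := `|g1 r - g2 r| / 3.
  have e0 : 0 < e by rewrite divr_gt0// normr_gt0 subr_eq0; apply/eqP.
  have [d1 d10 d1P] := continuous_ball (gc g1 r s1 rab) e0.
  have [d2 d20 d2P] := continuous_ball (gc g2 r s2 rab) e0.
  have [|s [[_ es] /= sd]] := clB (ball_ Num.norm r (Num.min d1 d2)).
    by apply/nbhs_normP; exists (Num.min d1 d2) => //=; rewrite lt_min d10.
  move: sd; rewrite /ball_/= distrC => /ltW; rewrite le_min => /andP[/d1P k1 /d2P k2].
  have : `|g1 r - g2 r| <= e + e.
    rewrite -(subrKA (g1 s)) [X in _ + (X - _)]es.
    by apply: (le_trans (ler_normD _ _)); rewrite lerD// distrC.
  rewrite /e; have : 0 < `|g1 r - g2 r| by rewrite normr_gt0 subr_eq0; apply/eqP.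
  lra.
Qed.

Lemma sol_on_sub (a b a' b' : R) g : a <= a' -> b' <= b -> sol_on a b g -> sol_on a' b' g.
Proof.
move=> aa bb s r /andP[? ?]; apply: s; apply/andP; split; lra.
Qed.

Lemma flow_sol (a b t : R) (g : R -> 'cV[R]_n) q : a < 0 < b -> a < t < b ->
  sol_on a b g -> flow Om F t (g 0) q -> q = g t.
Proof.
move=> /andP[a0 b0] /andP[at_ tb] s [g' [a' [b' [/andP[a0' b0'] /andP[at' tb'] e0 <- s']]]].
apply: (@sol_unique (Num.max a a') (Num.min b b')) => //.
- by rewrite gt_max lt_min a0 b0 a0'.
- by apply: sol_on_sub s'; [rewrite le_max lexx orbT|rewrite ge_min lexx orbT].
- by apply: sol_on_sub s; [rewrite le_max lexx|rewrite ge_min lexx].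
- by rewrite gt_max lt_min at_ at' tb.
Qed.

(** [G] agrees with [F] on [N] only, and the curve may leave [N] right after time
    [0]. A short solution of the original equation is therefore glued at [0],
    because [flow] asks for an open interval of existence around [0]. *)
Lemma backward_curve_extends (N : set 'cV[R]_n) (G : 'cV[R]_n -> 'cV[R]_n)
    (g : R -> 'cV[R]_n) :
  N `<=` Om -> (forall p, N p -> G p = F p) -> integral_curve G g ->
  (forall t, t <= 0 -> N (g t)) ->
  exists g' : R -> 'cV[R]_n, exists2 b : R, 0 < b &
    (forall t, t <= 0 -> g' t = g t) /\ forall a, sol_on a b g'.
Proof.
move=> NOm GF gG gN.
have [G2 [e [K [e0 K0 GK G2F]]]] := local_extension (NOm _ (gN 0 (lexx 0))).
have [g2 g20 g2G] := picard (g 0) K0 GK.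
have [d d0 dP] := continuous_ball (is_derive_continuous (g2G 0)) e0.
exists (fun t => if t <= 0 then g t else g2 t), d => //; split; first by move=> t ->.
move=> a r /andP[_ rd]; have [r0|r0|r0] := ltgtP r 0.
- split; first exact/NOm/gN/ltW.
  rewrite -GF; last exact/gN/ltW.
  apply: (@near_eq_is_derive _ _ _ g) => //.
  by near=> s; rewrite ifT// ltW//; near: s; exact: lt_nbhsl.
- have [Or G2r] : Om (g2 r) /\ G2 (g2 r) = F (g2 r).
    by apply: G2F; rewrite -g20; apply: dP; rewrite subr0 gtr0_norm// ltW.
  split => //; rewrite -G2r.
  apply: (@near_eq_is_derive _ _ _ g2) => //.
  by near=> s; rewrite ifF//; apply/negbTE; rewrite -ltNge; near: s; exact: lt_nbhsr.
- rewrite r0; split; first exact/NOm/gN.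
  have N0 := gN 0 (lexx 0).
  apply: glue_derive; first by rewrite g20.
    by rewrite -GF.
  have [|_ <-] := G2F (g 0); first by rewrite subrr normr0 ltW.
  by rewrite -[in X in is_derive _ _ _ (G2 X)]g20.
Unshelve. all: by end_near. Qed.

End OpenDomain.

End OmSolutions.

(** * Cone conditions *)

(** For [0 < beta], the cone [0 <= cone_form beta z] consists of the [z] whose second
    component is at most [beta ^ (-1/2)] times as long as the first. *)
Definition cone_form (R : realType) (u s : nat) (beta : R) (z : 'cV[R]_(u + s)) : R :=
  sqn (usubmx z) - beta * sqn (dsubmx z).

Section Cones.
Context {R : realType}.

Lemma opnorm_has_sup m n (A : 'M[R]_(m, n)) :
  has_sup [set enorm (A *m x) | x in [set x : 'cV[R]_n | enorm x <= 1]].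
Proof.
split.
  exists (enorm (A *m 0)), 0 => //=.
  by rewrite enorm_le// sqn0 expr1n.
exists (m.+1%:R * (n%:R * `|A|)) => _ [x /= x1 <-].
have c0 : 0 <= n%:R * `|A| by rewrite mulr_ge0.
rewrite enorm_le ?mulr_ge0//.
apply: (le_trans (sqn_le_norm _)).
apply: (@le_trans _ _ (m%:R * (n%:R * `|A|) ^+ 2)).
  rewrite ler_wpM2l// lerXn2r ?nnegrE//.
  apply: (le_trans (mulmx_norm_le _ _)).
  by rewrite ler_piMr// (le_trans (norm_le_enorm x)).
rewrite [leRHS]exprMn ler_wpM2r ?sqr_ge0// -natrX ler_nat.
by rewrite (leq_trans (leqnSn m))// leq_pmulr.
Qed.

Lemma opnorm_ub m n (A : 'M[R]_(m, n)) (x : 'cV[R]_n) : enorm x <= 1 ->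
  enorm (A *m x) <= opnorm A.
Proof.
move=> x1; apply: sup_upper_bound; first exact: opnorm_has_sup.
by exists x.
Qed.

Lemma opnorm_ge0 m n (A : 'M[R]_(m, n)) : 0 <= opnorm A.
Proof.
apply: le_trans (enorm_ge0 (A *m 0)) _; apply: opnorm_ub.
by rewrite enorm_le// sqn0 expr1n.
Qed.

Lemma enorm_mulmx m n (A : 'M[R]_(m, n)) (x : 'cV[R]_n) :
  enorm (A *m x) <= opnorm A * enorm x.
Proof.
have [->|x0] := eqVneq x 0.
  by rewrite mulmx0 enorm_le ?sqn0 ?mulr_ge0 ?opnorm_ge0 ?enorm_ge0// sqr_ge0.
have ex : 0 < enorm x.
  rewrite lt_neqAle enorm_ge0 andbT eq_sym; apply: contra_neq x0 => e0.
  by apply: sqn_eq0; rewrite -sqr_enorm e0 expr0n.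
have := @opnorm_ub m n A ((enorm x)^-1 *: x).
rewrite -scalemxAr !enormZ ger0_norm ?invr_ge0 ?(ltW ex)// mulVf ?gt_eqF// => /(_ (lexx _)).
by rewrite ler_pdivrMl// mulrC.
Qed.

Lemma entry_le_opnorm m n (A : 'M[R]_(m, n)) i j : `|A i j| <= opnorm A.
Proof.
have -> : A i j = (A *m delta_mx j (0 : 'I_1)) i 0 by rewrite -colE mxE.
apply: (le_trans (coord_le_norm _ _)); apply: (le_trans (norm_le_enorm _)).
apply: opnorm_ub; rewrite enorm_le// expr1n /sqn (bigD1 j)//= mxE !eqxx.
by rewrite big1 ?addr0 ?expr1n// => k kj; rewrite mxE (negbTE kj) expr0n.
Qed.

Lemma sqn_mulmx m n (A : 'M[R]_(m, n)) (x : 'cV[R]_n) :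
  sqn (A *m x) <= opnorm A ^+ 2 * sqn x.
Proof.
by rewrite -!sqr_enorm -exprMn lerXn2r ?nnegrE ?mulr_ge0 ?enorm_ge0 ?opnorm_ge0// enorm_mulmx.
Qed.

(** Young's inequality with weight [opnorm A]. *)
Lemma dotv_opnorm m n (A : 'M[R]_(m, n)) (x : 'cV[R]_m) (y : 'cV[R]_n) :
  `|dotv x (A *m y)| <= 2^-1 * opnorm A * (sqn x + sqn y).
Proof.
set a := opnorm A; have := opnorm_ge0 A; rewrite -/a le_eqVlt => /predU1P[a0|a0].
  have -> : A *m y = 0.
    by apply: sqn_eq0; apply: le_trans (sqn_mulmx _ _) _; rewrite -/a -a0 expr0n mul0r.
  rewrite /dotv big1; last by move=> i _; rewrite mxE mulr0.
  by rewrite normr0 -a0 mulr0 mul0r.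
have h : `|dotv x (A *m y)| <= 2^-1 * (a * sqn x + a^-1 * sqn (A *m y)).
  apply: (le_trans (ler_norm_sum _ _ _)).
  rewrite /sqn !mulr_sumr -big_split/= mulr_sumr; apply: ler_sum => i _.
  move: (x i 0) ((A *m y) i 0) => v w.
  rewrite ler_norml; apply/andP; split; rewrite -subr_ge0.
    rewrite (_ : _ - _ = 2^-1 * a^-1 * (a * v + w) ^+ 2); last by field; rewrite gt_eqF.
    by rewrite mulr_ge0 ?sqr_ge0// mulr_ge0// invr_ge0 ltW.
  rewrite (_ : _ - _ = 2^-1 * a^-1 * (a * v - w) ^+ 2); last by field; rewrite gt_eqF.
  by rewrite mulr_ge0 ?sqr_ge0// mulr_ge0// invr_ge0 ltW.
apply: (le_trans h); rewrite -mulrA ler_pM2l// mulrDr lerD2l.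
by rewrite ler_pdivrMl// mulrA -expr2 sqn_mulmx.
Qed.

Lemma qform_dotv k (A : 'M[R]_k) (x : 'cV[R]_k) : qform A x = dotv x (A *m x).
Proof.
by rewrite /qform -mulmxA mxE; apply: eq_bigr => i _; rewrite mxE.
Qed.

Lemma dotvDr k (x y z : 'cV[R]_k) : dotv x (y + z) = dotv x y + dotv x z.
Proof. by rewrite /dotv -big_split; apply: eq_bigr => i _; rewrite mxE mulrDr. Qed.

Lemma dotvZr k a (x y : 'cV[R]_k) : dotv x (a *: y) = a * dotv x y.
Proof. by rewrite /dotv mulr_sumr; apply: eq_bigr => i _; rewrite mxE mulrCA. Qed.

Lemma dotvv k (x : 'cV[R]_k) : dotv x x = sqn x.
Proof. by rewrite /dotv; apply: eq_bigr => i _; rewrite -expr2. Qed.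

Lemma qform_shift k (A : 'M[R]_k) a (x : 'cV[R]_k) :
  qform (A + a%:M) x = qform A x + a * sqn x.
Proof. by rewrite !qform_dotv mulmxDl dotvDr mul_scalar_mx dotvZr dotvv. Qed.

Lemma dotv0l k (y : 'cV[R]_k) : dotv 0 y = 0.
Proof. by rewrite /dotv big1// => i _; rewrite mxE mul0r. Qed.

Section Split.
Variables u s : nat.
Implicit Type z : 'cV[R]_(u + s).

Lemma sqn_split z : sqn z = sqn (usubmx z) + sqn (dsubmx z).
Proof.
by rewrite /sqn big_split_ord/=; congr (_ + _); apply: eq_bigr => i _; rewrite mxE.
Qed.

Lemma usubmx_mul (A : 'M[R]_(u + s)) z :
  usubmx (A *m z) = ulsubmx A *m usubmx z + ursubmx A *m dsubmx z.
Proof. by rewrite -{1}(submxK A) -{1}(vsubmxK z) mul_block_col col_mxKu. Qed.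

Lemma dsubmx_mul (A : 'M[R]_(u + s)) z :
  dsubmx (A *m z) = dlsubmx A *m usubmx z + drsubmx A *m dsubmx z.
Proof. by rewrite -{1}(submxK A) -{1}(vsubmxK z) mul_block_col col_mxKd. Qed.

(** The off-diagonal terms are split evenly between [sqn x] and [sqn y]. The shifts in
    the hypotheses are exactly what this costs in each component. *)
Lemma cone_rate (A : 'M[R]_(u + s)) (c beta : R) : 0 < beta ->
  (forall x : 'cV[R]_u, x != 0 -> c * enorm x ^+ 2 <
     qform (ulsubmx A - (2^-1 * (opnorm (ursubmx A) + beta * opnorm (dlsubmx A)))%:M) x) ->
  (forall y : 'cV[R]_s, y != 0 ->
     qform (drsubmx A + (2^-1 * (opnorm (dlsubmx A) + beta^-1 * opnorm (ursubmx A)))%:M) y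
     < c * enorm y ^+ 2) ->
  forall z, c * cone_form beta z <=
    dotv (usubmx z) (usubmx (A *m z)) - beta * dotv (dsubmx z) (dsubmx (A *m z)).
Proof.
move=> b0 hx hy z; rewrite usubmx_mul dsubmx_mul !dotvDr /cone_form.
set x := usubmx z; set y := dsubmx z.
set e1 := ursubmx A; set e2 := dlsubmx A.
have h1 : c * sqn x <= dotv x (ulsubmx A *m x) - 2^-1 * (opnorm e1 + beta * opnorm e2) * sqn x.
  have [->|x0] := eqVneq x 0; first by rewrite dotv0l sqn0 !mulr0 subrr.
  by have := hx x x0; rewrite -scalemx1 -scaleNr scalemx1 qform_shift
    sqr_enorm mulNr qform_dotv => /ltW.
have h2 : dotv y (drsubmx A *m y) + 2^-1 * (opnorm e2 + beta^-1 * opnorm e1) * sqn y <= c * sqn y.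
  have [->|y0] := eqVneq y 0; first by rewrite dotv0l sqn0 !mulr0 addr0.
  by have := hy y y0; rewrite qform_shift sqr_enorm qform_dotv => /ltW.
have h3 := dotv_opnorm e1 x y; have h4 := dotv_opnorm e2 y x.
move: h3 h4; rewrite !ler_norml => /andP[h3 _] /andP[_ h4].
have h2' := h2; rewrite -(ler_pM2l b0) in h2'.
rewrite -(ler_pM2l b0) in h4.
have E : beta * (2^-1 * (opnorm e2 + beta^-1 * opnorm e1) * sqn y) =
    2^-1 * (beta * opnorm e2 + opnorm e1) * sqn y by field; rewrite gt_eqF.
rewrite mulrDr E in h2'.
move: h1 h2' h3 h4; lra.
Qed.

Lemma is_derive_cone_form beta (d : R -> 'cV[R]_(u + s)) (t : R) (v : 'cV[R]_(u + s)) :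
  is_derive t 1 d v ->
  is_derive t 1 (fun r : R => cone_form beta (d r))
    (2 * (dotv (usubmx (d t)) (usubmx v) - beta * dotv (dsubmx (d t)) (dsubmx v))).
Proof.
move=> dv.
have du : is_derive t 1 (fun r : R => usubmx (d r)) (usubmx v).
  apply: is_derive_of_coord => i; rewrite mxE.
  by under eq_fun do rewrite mxE; exact: is_derive_coord.
have dd : is_derive t 1 (fun r : R => dsubmx (d r)) (dsubmx v).
  apply: is_derive_of_coord => i; rewrite mxE.
  by under eq_fun do rewrite mxE; exact: is_derive_coord.
have h1 := is_derive_sqn du; have h2 := is_deriveZ beta (is_derive_sqn dd).
have := is_deriveB h1 h2; rewrite /GRing.scale/= => h3.
by apply: is_derive_eq; ring.
Qed.

(** Along two integral curves of [G], the derivative of [cone_form beta] of their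
    difference is at least [2 * c] times its value. *)
Definition cone_rated (G : 'cV[R]_(u + s) -> 'cV[R]_(u + s)) (beta c : R) :=
  forall p q, c * cone_form beta (p - q) <=
    dotv (usubmx (p - q)) (usubmx (G p - G q)) -
    beta * dotv (dsubmx (p - q)) (dsubmx (G p - G q)).

Lemma cone_form_growth (G : 'cV[R]_(u + s) -> 'cV[R]_(u + s)) (beta c : R)
    (g1 g2 : R -> 'cV[R]_(u + s)) (a b : R) :
  cone_rated G beta c -> integral_curve G g1 -> integral_curve G g2 -> a <= b ->
  cone_form beta (g1 a - g2 a) * expR (2 * c * (b - a)) <= cone_form beta (g1 b - g2 b).
Proof.
move=> Gc G1 G2 ab.
apply: (@exp_growth R (fun r => cone_form beta (g1 r - g2 r)) _ a b (2 * c) ab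
  (fun x _ => is_derive_cone_form beta (is_deriveB (G1 x) (G2 x)))) => x _.
by rewrite -mulrA ler_pM2l.
Qed.

End Split.

End Cones.

(** * Backward curves inside the cone *)

Section Reach.
Context {R : realType}.

Lemma half_contraction_fixed n (f : 'cV[R]_n -> 'cV[R]_n) :
  (forall x y, `|f x - f y| <= 2^-1 * `|x - y|) -> exists x, x = f x.
Proof.
move=> fc; pose v k := iter k f 0.
have [k|x xP] := @cvg_of_geometric R n v `|f 0|.
  elim: k => [|k ih]; first by rewrite /v/= subr0 expr0 mulr1.
  by apply: (le_trans (fc _ _)); rewrite exprS mulrCA ler_pM2l.
exists x; apply/esym/eqP; rewrite -subr_eq0 -normr_le0; apply/ler_addgt0Pr => e e0.
rewrite add0r; have [k kP] := half_pow_small (2 * `|f 0|) e0.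
have h1 := fc x (v k); have h2 := xP k; have h3 := xP k.+1.
rewrite -(subrKA (v k.+1)); apply: le_trans (ler_normD _ _) _.
rewrite (distrC (v k.+1)); move: h3 h1 h2 kP; rewrite exprS /v /=; lra.
Qed.

Lemma zero_integral_curve n (G : 'cV[R]_n -> 'cV[R]_n) : G 0 = 0 ->
  integral_curve G (fun=> 0).
Proof. by move=> G0 t; rewrite G0; exact: is_derive_cst. Qed.

Lemma increment_le n (G : 'cV[R]_n -> 'cV[R]_n) (K B h : R) (g1 g2 : R -> 'cV[R]_n) :
  0 <= h -> 0 <= K -> 0 <= B -> lipschitz_field G K ->
  integral_curve G g1 -> integral_curve G g2 ->
  (forall t, 0 <= t <= h -> `|g1 t - g2 t| <= B) ->
  `|(g1 h - g2 h) - (g1 0 - g2 0)| <= K * B * h.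
Proof.
move=> h0 K0 B0 GK G1 G2 gB; apply: norm_le_coord; first by rewrite !mulr_ge0.
move=> i.
have d (t : R) : is_derive t 1 (fun s : R => (g1 s - g2 s) i 0) ((G (g1 t) - G (g2 t)) i 0).
  exact: (is_derive_coord i (is_deriveB (G1 t) (G2 t))).
have [|t] := @MVT_segment R (fun s : R => (g1 s - g2 s) i 0)
  (fun t => (G (g1 t) - G (g2 t)) i 0) 0 h h0.
  by apply: derivable_within_continuous => x _; have [] := d x.
rewrite in_itv/= => t0h E.
have -> : (g1 h - g2 h - (g1 0 - g2 0)) i 0 = (g1 h - g2 h) i 0 - (g1 0 - g2 0) i 0.
  by rewrite !mxE.
rewrite E subr0 normrM (ger0_norm h0) ler_wpM2r//.
apply: (le_trans (coord_le_norm _ _)); apply: (le_trans (GK _ _)).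
by rewrite ler_wpM2l// gB.
Qed.

Section Cone.
Variables (u s : nat) (G : 'cV[R]_(u + s) -> 'cV[R]_(u + s)) (K beta c : R).
Hypotheses (K0 : 0 < K) (GK : lipschitz_field G K) (beta1 : 1 <= beta).
Hypothesis Gc : cone_rated G beta c.

Lemma cone_forward (g1 g2 : R -> 'cV[R]_(u + s)) (a b : R) :
  integral_curve G g1 -> integral_curve G g2 -> a <= b ->
  0 <= cone_form beta (g1 a - g2 a) -> 0 <= cone_form beta (g1 b - g2 b).
Proof.
move=> G1 G2 ab h; apply: le_trans (cone_form_growth Gc G1 G2 ab).
by rewrite mulr_ge0// expR_ge0.
Qed.

Lemma cone_sqn_le (z : 'cV[R]_(u + s)) : 0 <= cone_form beta z ->
  sqn z <= 2 * sqn (usubmx z).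
Proof.
rewrite /cone_form subr_ge0 sqn_split => h.
have : sqn (dsubmx z) <= beta * sqn (dsubmx z) by rewrite ler_peMl// sqn_ge0.
lra.
Qed.

Lemma norm_usubmx (z : 'cV[R]_(u + s)) : `|usubmx z| <= `|z|.
Proof. by apply: norm_le_coord => // i; rewrite mxE coord_le_norm. Qed.

(** The two-point boundary value problem: start at time [- T] on the horizontal plane
    [y = 0] and end at time [0] above [x]. *)
Definition reaches (T : R) := forall x : 'cV[R]_u, exists g : R -> 'cV[R]_(u + s),
  [/\ integral_curve G g, dsubmx (g (- T)) = 0 & usubmx (g 0) = x].

Lemma reaches0 : reaches 0.
Proof.
move=> x; have [g g0 Gg] := picard (col_mx x 0) K0 GK.
by exists g; rewrite oppr0 g0 col_mxKd col_mxKu.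
Qed.

(** One step length [h] serves for all [T]. Solutions through two points of the plane
    [y = 0] differ by a vector of the cone at all later times, so the end points of
    the curves given for [T] form a Lipschitz graph over [x]. Following this graph
    for the time [h] displaces its projection to the first factor by a map with
    Lipschitz constant [1/2]; such a perturbation of the identity is onto the whole
    factor. *)
Lemma reaches_step : exists2 h : R, 0 < h &
  forall T, 0 <= T -> reaches T -> reaches (T + h).
Proof.
pose B := 2 * u%:R * expR (2 * (u + s)%:R * K) + 1.
(* [B] bounds its own square root, which saves extracting one below *)
have B1 : 1 <= B by rewrite lerDr !mulr_ge0// expR_ge0.
have B0 : 0 <= B by exact: le_trans B1.
pose h := (2 * K * B + 1)^-1.
have KB : 0 <= K * B by rewrite mulr_ge0// ltW.
have h0 : 0 < h by rewrite invr_gt0; lra.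
have h1 : h <= 1 by rewrite invf_le1; lra.
have KBh : K * B * h <= 2^-1 by rewrite ler_pdivrMr; lra.
exists h => // T T0 /choice[g gP].
have Gg x := let: And3 a _ _ := gP x in a.
have g_flat x := let: And3 _ a _ := gP x in a.
have g_x x := let: And3 _ _ a := gP x in a.
move=> x0.
have close x y t : 0 <= t <= h -> `|g x t - g y t| <= B * `|x - y|.
  move=> /andP[t0 th].
  have V0 : 0 <= cone_form beta (g x 0 - g y 0).
    apply: (@cone_forward _ _ (- T)) => //; first by rewrite oppr_le0.
    by rewrite /cone_form linearB [dsubmx _]linearB/= !g_flat subrr sqn0 mulr0 subr0 sqn_ge0.
  have S0 := cone_sqn_le V0; rewrite linearB/= !g_x in S0.
  have [St _] := gronwall (ltW K0) GK t0 (fun r _ => Gg x r) (fun r _ => Gg y r).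
  rewrite subr0 in St.
  rewrite -(@ler_pXn2r _ 2) ?nnegrE ?mulr_ge0//.
  apply: (le_trans (normsq_le_sqn _)); apply: (le_trans St).
  have E : expR (2 * (u + s)%:R * K * t) <= expR (2 * (u + s)%:R * K).
    by rewrite ler_expR ler_piMr ?mulr_ge0 ?(ltW K0)// (le_trans th).
  apply: (@le_trans _ _ ((2 * (u%:R * `|x - y| ^+ 2)) * expR (2 * (u + s)%:R * K))).
    rewrite ler_pM ?sqn_ge0 ?expR_ge0//; apply: (le_trans S0).
    by rewrite ler_pM2l// sqn_le_norm.
  rewrite exprMn (_ : _ * expR _ = (B - 1) * `|x - y| ^+ 2); last by rewrite /B; ring.
  rewrite ler_wpM2r ?sqr_ge0// expr2; apply: (@le_trans _ _ B); first by rewrite gerBl.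
  by rewrite ler_peMl.
have [x xE] : exists x, x = x0 - (usubmx (g x h) - x).
  apply: (@half_contraction_fixed u (fun x => x0 - (usubmx (g x h) - x))) => x y.
  have -> : x0 - (usubmx (g x h) - x) - (x0 - (usubmx (g y h) - y)) =
      - usubmx ((g x h - g y h) - (g x 0 - g y 0)).
    by apply/matrixP => i j; rewrite !linearB/= !g_x !mxE; ring.
  rewrite normrN; apply: (le_trans (norm_usubmx _)).
  have /le_trans := increment_le (ltW h0) (ltW K0) (mulr_ge0 B0 (normr_ge0 _)) GK
    (Gg x) (Gg y) (close x y).
  by apply; rewrite mulrA mulrAC ler_wpM2r.
(* restart the clock so that the curve ends at time [0] again *)
exists (fun t => g x (t + h)); split.
- exact: integral_curve_shift.
- by rewrite opprD addrNK g_flat.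
- rewrite add0r; apply/eqP; rewrite -subr_eq0 -oppr_eq0 opprB; apply/eqP.
  move: xE => /eqP; rewrite -subr_eq0 => /eqP xE.
  rewrite -[RHS]oppr0 -xE; apply/matrixP => i j; rewrite !mxE; ring.
Qed.

Lemma reaches_all : exists2 h : R, 0 < h & forall k : nat, reaches (k%:R * h).
Proof.
have [h h0 hP] := reaches_step; exists h => //; elim=> [|k ih].
  by rewrite mul0r; exact: reaches0.
by rewrite -natr1 mulrDl mul1r; apply: hP => //; rewrite mulr_ge0// ltW.
Qed.

Lemma bounded_cluster n (q : nat -> 'cV[R]_n) (M : R) : (forall k, `|q k| <= M) ->
  exists p, forall e N, 0 < e -> exists2 k, (N <= k)%N & `|q k - p| <= e.
Proof.
move=> qM; pose A := [set v : 'rV[R]_n | `|v| <= M].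
have tr_norm (v : 'cV[R]_n) : `|v^T| <= `|v|.
  rewrite [leLHS]/Num.norm/= mx_normrE; apply: bigmax_le => //= -[i j] _ /=.
  by rewrite mxE (ord1 i) coord_le_norm.
have tr_norm' (v : 'rV[R]_n) : `|v^T| <= `|v|.
  by apply: norm_le_coord => // i; rewrite mxE mxcoord_le_norm.
have cA : compact A.
  apply: bounded_closed_compact.
    by exists M; split; [exact: num_real|move=> x Mx v /le_trans; apply; exact: ltW].
  apply: (@preimage_closed _ _ (fun v : 'rV[R]_n => `|v|) [set z | z <= M]).
    by move=> z _; exact: norm_continuous.
  exact: closed_le.
have [|p [Ap clp]] := cA ((fun k => (q k)^T) @ \oo).
  by exists 0%N => // k _; exact: le_trans (tr_norm _) (qM k).
exists p^T => e N e0.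
have [||v [/= [k Nk <-] /= pv]] :=
    clp [set (q k)^T | k in [set k | (N <= k)%N]] (ball p e).
- by exists N => // k Nk; exists k.
- exact: nbhsx_ballx.
move: pv; rewrite -ball_normE /ball_/= => pv.
exists k => //; apply: ltW; apply: le_lt_trans pv; rewrite distrC -[leLHS]/(`|p^T - q k|).
by rewrite -{1}[q k]trmxK -linearB; exact: tr_norm'.
Qed.

Lemma cone_form_continuous : continuous (@cone_form R u s beta).
Proof.
have -> : @cone_form R u s beta = fun z : 'cV[R]_(u + s) =>
    \sum_(i < u) z (lshift s i) 0 ^+ 2 - beta * \sum_(i < s) z (rshift u i) 0 ^+ 2.
  apply/funext => z; rewrite /cone_form /sqn; congr (_ - _ * _);
  by apply: eq_bigr => i _; rewrite mxE.
have sq i : continuous (fun z : 'cV[R]_(u + s) => z i 0 ^+ 2).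
  by move=> z; under eq_fun do rewrite expr2; apply: continuousM; exact: continuous_coord.
have c1 := @continuous_sum R _ _ (index_enum 'I_u) _ (fun i => sq (lshift s i)).
have c2 := @continuous_sum R _ _ (index_enum 'I_s) _ (fun i => sq (rshift u i)).
have gen (T : topologicalType) (f g : T -> R) :
    continuous f -> continuous g -> continuous (fun z => f z - beta * g z).
  by move=> fc gc z; apply: cvgB; [exact: fc|apply: cvgM; [exact: cvg_cst|exact: gc]].
exact: gen c1 c2.
Qed.

Hypothesis G0 : G 0 = 0.

(** The initial points of the curves for [T = k * h] are bounded because they lie in
    the cone. A cluster point of them works: by continuous dependence on the
    initial point, leaving the cone at some [t <= 0] would be inherited by the
    curves with large [k], which are still in the cone at [t]. *)
Lemma backward_cone_curve (x : 'cV[R]_u) : exists g : R -> 'cV[R]_(u + s),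
  [/\ integral_curve G g, usubmx (g 0) = x &
      forall t, t <= 0 -> 0 <= cone_form beta (g t)].
Proof.
have [h h0 hP] := reaches_all.
have /choice[g gP] k := hP k x.
have Gg k := let: And3 a _ _ := gP k in a.
have g_flat k := let: And3 _ a _ := gP k in a.
have g_x k := let: And3 _ _ a := gP k in a.
have gV k t : - (k%:R * h) <= t -> 0 <= cone_form beta (g k t).
  move=> kt; rewrite -(subr0 (g k t)).
  apply: (@cone_forward (g k) (fun=> 0) _ _ (Gg k) (zero_integral_curve G0) kt).
  by rewrite subr0 /cone_form g_flat sqn0 mulr0 subr0 sqn_ge0.
have [|p pP] := @bounded_cluster (u + s) (fun k => g k 0) (2 * sqn x + 1).
  move=> k; have V0 : 0 <= cone_form beta (g k 0).
    by apply: gV; rewrite oppr_le0 mulr_ge0// ltW.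
  have := cone_sqn_le V0; rewrite g_x => S.
  have := normsq_le_sqn (g k 0); have := sqr_ge0 (`|g k 0| - 1); have := sqn_ge0 x.
  rewrite sqrrB expr1n mulr1; move: S; rewrite mulr2n; lra.
have [g' g'0 Gg'] := picard p K0 GK.
exists g'; split => //.
  apply/eqP; rewrite -subr_eq0 -normr_le0; apply/ler_addgt0Pr => e e0; rewrite add0r.
  have [k _ ke] := pP e 0%N e0.
  by rewrite -(g_x k) g'0 -linearB/= (le_trans (norm_usubmx _))// distrC.
move=> t t0; rewrite leNgt; apply/negP => V0.
have [d d0 dP] : exists2 d : R, 0 < d & forall z, `|z - g' t| <= d -> cone_form beta z < 0.
  apply: (@open_ball R _ [set z | cone_form beta z < 0]) => //.
  apply: (@open_comp _ _ (@cone_form R u s beta) [set z | z < 0]); last exact: open_lt.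
  by move=> z _; exact: cone_form_continuous.
pose E := expR (2 * (u + s)%:R * K * (0 - t)).
have E1 : 1 <= E by rewrite -expR0 ler_expR !mulr_ge0 ?(ltW K0)//; lra.
(* [e] is such that a curve starting within [e] of [p] is still within [d] of [g']
   at time [t], [E] being the Gronwall factor *)
pose e := d / ((u + s).+1%:R * E).
have e0 : 0 < e by rewrite divr_gt0// mulr_gt0//; lra.
pose N := Num.bound (- t / h).
have [k Nk ke] := pP e N e0.
have tk : - (k%:R * h) <= t.
  rewrite lerNl -ler_pdivrMr//; have : - t / h < N%:R.
    by apply: archi_boundP; rewrite divr_ge0 ?oppr_ge0// ltW.
  by move=> /ltW /le_trans; apply; rewrite ler_nat.
have := gV k t tk; rewrite leNgt => /negP; apply; apply: dP.
have [_] := gronwall (ltW K0) GK t0 (fun r _ => Gg k r) (fun r _ => Gg' r).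
rewrite g'0 -/E => S.
rewrite -(@ler_pXn2r _ 2) ?nnegrE ?(ltW d0)//.
apply: (le_trans (normsq_le_sqn _)); apply: (le_trans S).
have S2 : sqn (g k 0 - p) <= (u + s)%:R * e ^+ 2.
  apply: (le_trans (sqn_le_norm _)); rewrite ler_wpM2l// lerXn2r ?nnegrE ?(ltW e0)//.
apply: (@le_trans _ _ ((u + s)%:R * e ^+ 2 * E)).
  by rewrite ler_wpM2r// expR_ge0.
have n1 : (u + s)%:R <= ((u + s).+1%:R : R) ^+ 2.
  by rewrite -natrX ler_nat (leq_trans (leqnSn _))// leq_pmulr.
have m0 : 0 < ((u + s).+1%:R : R) by [].
have -> : d = e * ((u + s).+1%:R * E) by rewrite divfK// gt_eqF// mulr_gt0//; lra.
have -> : (u + s)%:R * e ^+ 2 * E = e ^+ 2 * ((u + s)%:R * E) by ring.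
clearbody e; rewrite exprMn ler_wpM2l ?sqr_ge0// exprMn ler_pM ?expR_ge0//.
by rewrite expr2 ler_peMl// expR_ge0.
Qed.

End Cone.

End Reach.

(** * Points of the strong unstable manifold *)

Section Unstable.
Context {R : realType} (u s : nat).
Variables (Om N : set 'cV[R]_(u + s)) (F G : 'cV[R]_(u + s) -> 'cV[R]_(u + s)) (K : R).
Hypotheses (hOm : open Om) (hF : C1_on Om F) (NOm : N `<=` Om).
Hypotheses (K0 : 0 < K) (GK : lipschitz_field G K) (GF : forall p, N p -> G p = F p).

(** [strong_unstable] provides a solution separately for each time. By uniqueness they
    are restrictions of one another, so each stays in [N] back to its own time and
    there solves the extended equation. *)
Lemma strong_unstable_curve (lambda : R) (p : 'cV[R]_(u + s)) :
  strong_unstable Om F N lambda p ->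
  exists g, [/\ integral_curve G g, g 0 = p &
    exists2 C : R, 0 < C & forall t, t <= 0 -> enorm (g t) <= C * expR (t * lambda)].
Proof.
move=> [pN [C C0 Cd]]; have [g g0 Gg] := picard p K0 GK.
exists g; split => //; exists C => // t t0; apply: Cd => //.
have [q fq _] := pN t t0; move: (fq) => [g' [a [b [/andP[a0 b0] /andP[at_ tb] g'0 g't s']]]].
have inN r : t <= r <= 0 -> N (g' r).
  move=> /andP[tr r0]; have [q' fq' Nq'] := pN r r0.
  suff <- : q' = g' r by [].
  apply: (@flow_sol R _ Om F hOm hF a b r g') => //; last by rewrite g'0.
    by rewrite a0.
  by apply/andP; split; lra.
suff <- : q = g t by [].
rewrite -g't; apply: (@integral_curve_unique R _ G K g' g t 0 0) => //.
- exact: ltW.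
- move=> r tr; rewrite GF; last exact: inN.
  by have [] := s' r _ => //; move: tr => /andP[? ?]; apply/andP; split; lra.
- by rewrite t0 lexx.
- by rewrite g'0.
- by rewrite lexx.
Qed.

Lemma curve_strong_unstable (lambda C : R) (g : R -> 'cV[R]_(u + s)) :
  integral_curve G g -> (forall t, t <= 0 -> N (g t)) -> 0 < C ->
  (forall t, t <= 0 -> enorm (g t) <= C * expR (t * lambda)) ->
  strong_unstable Om F N lambda (g 0).
Proof.
move=> Gg gN C0 gC.
have [g' [b b0 [g'g sg']]] := @backward_curve_extends R _ Om F hOm hF N G g NOm GF Gg gN.
have fl t : t <= 0 -> flow Om F t (g 0) (g t).
  move=> t0; exists g', (t - 1), b; split.
  - by rewrite b0 andbT; lra.
  - by apply/andP; split; lra.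
  - exact: g'g.
  - exact: g'g.
  - exact: sg'.
split; first by move=> t t0; exists (g t); [exact: fl|exact: gN].
exists C => // t q t0 fq.
suff -> : q = g t by exact: gC.
rewrite -(g'g t t0); apply: (@flow_sol R _ Om F hOm hF (t - 1) b t g') => //.
- by rewrite b0 andbT; lra.
- by apply/andP; split; lra.
- by rewrite (g'g 0).
Qed.

Variables (bh c_h c_v : R).
Hypotheses (bh0 : 0 < bh) (hc : c_h < c_v) (Gh : cone_rated G bh c_h).

(** Outside the cone the form is negative, and backward in time its modulus stays above
    a positive multiple of [exp (2 * c_h * t)]. The squared distance of two points of
    the manifold is below a multiple of [exp (2 * c_v * t)], which is eventually
    smaller. *)
Lemma strong_unstable_cone (p q : 'cV[R]_(u + s)) :
  strong_unstable Om F N c_v p -> strong_unstable Om F N c_v q ->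
  0 <= cone_form bh (p - q).
Proof.
move=> /strong_unstable_curve[g1 [G1 <- [C1 C10 d1]]].
move=> /strong_unstable_curve[g2 [G2 <- [C2 C20 d2]]].
rewrite leNgt; apply/negP => V0.
set V := cone_form bh (g1 0 - g2 0) in V0.
pose D := 2 * bh * (C1 ^+ 2 + C2 ^+ 2).
have D0 : 0 < D by rewrite !mulr_gt0// addr_gt0// exprn_gt0.
have key t : t <= 0 -> - V * expR (2 * c_h * t) <= D * expR (2 * c_v * t).
  move=> t0; have := cone_form_growth Gh G1 G2 t0; rewrite sub0r mulrN expRN.
  rewrite ler_pdivrMr ?expR_gt0// -/V => h; rewrite mulNr.
  have sq (C : R) (z : 'cV[R]_(u + s)) : 0 < C -> enorm z <= C * expR (t * c_v) ->
      sqn z <= C ^+ 2 * expR (2 * c_v * t).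
    move=> C0; rewrite enorm_le; last by rewrite mulr_ge0 ?expR_ge0// ltW.
    move=> /le_trans; apply; rewrite exprMn -expRM_natl mulrA.
    by rewrite le_eqVlt (_ : 2%:R * t * c_v = 2 * c_v * t) ?eqxx//; ring.
  have s1 := sq _ _ C10 (d1 t t0); have s2 := sq _ _ C20 (d2 t t0).
  have s3 := sqn_add_le (g1 t) (- g2 t); rewrite sqnN sqn_split in s3.
  have := sqn_ge0 (usubmx (g1 t - g2 t)) => s4.
  have s5 : sqn (dsubmx (g1 t - g2 t)) <= 2 * (C1 ^+ 2 + C2 ^+ 2) * expR (2 * c_v * t) by lra.
  rewrite -(ler_pM2l bh0) in s5.
  move: h; rewrite /cone_form /D; lra.
pose k := 2 * (c_v - c_h); have k0 : 0 < k by rewrite mulr_gt0// subr_gt0.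
have DV : 0 < D / (- V) by rewrite divr_gt0// oppr_gt0.
(* with this [t], [exp (k * t) <= 1 / (1 + D / - V) < - V / D] *)
have [t tE] : exists t, k * t = - (D / (- V)).
  by exists (- (D / (- V)) / k); rewrite mulrC divfK// gt_eqF.
have t0 : t <= 0 by rewrite -(pmulr_rle0 t k0) tE oppr_le0 ltW.
have := key t t0; have -> : 2 * c_v * t = 2 * c_h * t + k * t by rewrite /k; ring.
rewrite expRD mulrCA [leLHS]mulrC ler_pM2l ?expR_gt0// tE.
rewrite expRN leNgt => /negP; apply.
rewrite ltr_pdivrMr ?expR_gt0// mulrC -ltr_pdivrMr ?oppr_gt0//.
by apply: lt_le_trans (expR_ge1Dx _); rewrite ltrDr.
Qed.

End Unstable.

(** * The graph of the strong unstable manifold *)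

Section Assembly.
Context {R : realType} (u s : nat).

(** Inside the cone [0 <= cone_form bh] the form [cone_form av] is comparable to the
    squared length of the first component, from below with constant [1 - av].
    Since it grows at rate [2 * c], for [0 <= c] a curve that ends with [sqn x <= 1 - av] never
    had [1 < sqn x] before: this is where the radius [sqrt (1 - av)] comes from. *)
Lemma cone_curve_decay (G : 'cV[R]_(u + s) -> 'cV[R]_(u + s)) (bh av c : R)
    (g : R -> 'cV[R]_(u + s)) :
  1 <= bh -> 0 < av < 1 -> cone_rated G av c -> G 0 = 0 -> integral_curve G g ->
  (forall t, t <= 0 -> 0 <= cone_form bh (g t)) -> sqn (usubmx (g 0)) <= 1 - av ->
  forall t, t <= 0 -> sqn (dsubmx (g t)) <= sqn (usubmx (g t)) <= expR (2 * c * t).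
Proof.
move=> bh1 /andP[av0 av1] Gv G0 Gg gV g0 t t0.
have YX : sqn (dsubmx (g t)) <= sqn (usubmx (g t)).
  have := gV t t0; rewrite /cone_form subr_ge0; apply: le_trans.
  by rewrite ler_peMl// sqn_ge0.
rewrite YX /=.
have := cone_form_growth Gv Gg (zero_integral_curve G0) t0.
rewrite !subr0 sub0r mulrN expRN ler_pdivrMr ?expR_gt0// => h.
have V0 : cone_form av (g 0) <= 1 - av.
  by rewrite /cone_form; have := mulr_ge0 (ltW av0) (sqn_ge0 (dsubmx (g 0))); lra.
have av1' : 0 < 1 - av by rewrite subr_gt0.
rewrite -(ler_pM2l av1'); apply: (@le_trans _ _ (cone_form av (g t))).
  rewrite /cone_form mulrBl mul1r lerD2l lerN2.
  by rewrite ler_pM2l.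
by apply: (le_trans h); rewrite ler_pM2r ?expR_gt0.
Qed.

Lemma sqn_convex k (p q : 'cV[R]_k) t : 0 <= t <= 1 ->
  sqn (q + t *: (p - q)) <= (1 - t) * sqn q + t * sqn p.
Proof.
move=> /andP[t0 t1]; rewrite /sqn !mulr_sumr -big_split/=; apply: ler_sum => i _.
rewrite !mxE; move: (p i 0) (q i 0) => a b; rewrite -subr_ge0.
rewrite (_ : _ - _ = t * (1 - t) * (a - b) ^+ 2); last by ring.
by rewrite mulr_ge0 ?sqr_ge0// mulr_ge0// subr_ge0.
Qed.

Definition unit_cylinder : set 'cV[R]_(u + s) :=
  [set z | sqn (usubmx z) <= 1 /\ sqn (dsubmx z) <= 1].

Lemma unit_cylinder_convex : segment_convex unit_cylinder.
Proof.
move=> p q t [p1 p2] [q1 q2] t01; have /andP[t0 t1] := t01.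
have t1' : 0 <= 1 - t by rewrite subr_ge0.
split; rewrite linearD linearZ linearB/=; apply: le_trans (sqn_convex _ _ t01) _.
  have := ler_wpM2l t0 p1; have := ler_wpM2l t1' q1; lra.
have := ler_wpM2l t0 p2; have := ler_wpM2l t1' q2; lra.
Qed.

Lemma Dmx_enclosure n (F : 'cV[R]_n -> 'cV[R]_n) (V : set 'cV[R]_n) (L : R) p :
  (forall p, V p -> opnorm (Dmx F p) <= L) -> V p -> interval_enclosure F V (Dmx F p).
Proof.
move=> VL Vp i j.
have b q : V q -> - L <= Dmx F q i j <= L.
  by move=> Vq; rewrite -ler_norml (le_trans (entry_le_opnorm _ _ _))// VL.
apply/andP; split.
  apply: ge_inf; last by exists p.
  by exists (- L) => _ [q Vq <-]; have /andP[] := b q Vq.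
apply: sup_upper_bound; last by exists p.
split; first by exists (Dmx F p i j), p.
by exists L => _ [q Vq <-]; have /andP[] := b q Vq.
Qed.

End Assembly.

Theorem theorem32 (R : realType) (u s : nat)
  (Om : set 'cV[R]_(u + s)) (F : 'cV[R]_(u + s) -> 'cV[R]_(u + s))
  (N : set 'cV[R]_(u + s))
  (hN : N = prod_set (closed_eball (0 : 'cV[R]_u) 1)
                     (closed_eball (0 : 'cV[R]_s) 1))
  (hOm : open Om) (hNOm : N `<=` Om)
  (hF : C1_on Om F) (hF0 : F 0 = 0)
  (mu L M : R)
  (hmu : forall p, N p -> enorm (F p) <= mu)
  (hL : forall p, N p -> opnorm (Dmx F p) <= L)
  (hM : forall p1 p2, N p1 -> N p2 ->
     opnorm (Dmx F p1 - Dmx F p2) <= M * enorm (p1 - p2))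
  (bA : set 'M[R]_(u, u)) (bB : set 'M[R]_(s, s))
  (be1 : set 'M[R]_(u, s)) (be2 : set 'M[R]_(s, u))
  (hbA : interval_matrix bA) (hbB : interval_matrix bB)
  (hbe1 : interval_matrix be1) (hbe2 : interval_matrix be2)
  (hDF : interval_enclosure F N `<=` block_set bA be1 be2 bB)
  (alpha_h alpha_v c_h c_v : R)
  (hah : 0 < alpha_h < 1) (hav : 0 < alpha_v < 1)
  (hcone : forall A B e1 e2, bA A -> bB B -> be1 e1 -> be2 e2 ->
     (forall x : 'cV[R]_u, x != 0 ->
        c_h * enorm x ^+ 2 <
          qform (A - (2^-1 * (opnorm e1 + alpha_h^-1 * opnorm e2))%:M) x /\
        c_v * enorm x ^+ 2 <
          qform (A - (2^-1 * (opnorm e1 + alpha_v * opnorm e2))%:M) x) /\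
     (forall y : 'cV[R]_s, y != 0 ->
        qform (B + (2^-1 * (opnorm e2 + alpha_h * opnorm e1))%:M) y <
          c_h * enorm y ^+ 2 /\
        qform (B + (2^-1 * (opnorm e2 + alpha_v^-1 * opnorm e1))%:M) y <
          c_v * enorm y ^+ 2))
  (r_u : R) (hr_u : r_u = Num.sqrt (1 - alpha_v))
  (U : set 'cV[R]_(u + s))
  (hU : U = prod_set (closed_eball (0 : 'cV[R]_u) r_u)
                     (closed_eball (0 : 'cV[R]_s) 1))
  (hcvh : c_h < c_v) (hcv0 : 0 < c_v) :
  exists w : 'cV[R]_u -> 'cV[R]_s,
    [/\ forall x, closed_eball 0 r_u x -> closed_eball 0 1 (w x),
        strong_unstable Om F N c_v `&` U =
          [set col_mx x (w x) | x in closed_eball (0 : 'cV[R]_u) r_u] &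
        forall x1 x2, closed_eball 0 r_u x1 -> closed_eball 0 r_u x2 ->
          enorm (w x1 - w x2) <= Num.sqrt alpha_h * enorm (x1 - x2)].
Proof.
have /andP[ah0 ah1] := hah; have /andP[av0 av1] := hav.
have ru0 : 0 < r_u by rewrite hr_u sqrtr_gt0 subr_gt0.
have ru2 : r_u ^+ 2 = 1 - alpha_v by rewrite hr_u sqr_sqrtr// subr_ge0 ltW.
have bh1 : 1 <= alpha_h^-1 by rewrite invf_ge1// ltW.
have bh0 : 0 < alpha_h^-1 by rewrite invr_gt0.
have NE : N = @unit_cylinder R u s.
  by rewrite hN /prod_set /unit_cylinder !closed_eballE// expr1n.
have N0 : N 0 by rewrite NE; split; rewrite linear0 sqn0.
(* the smallest box containing [Dmx F] on [N] *)
pose lo : 'M[R]_(u + s) := \matrix_(i, j) inf [set Dmx F p i j | p in N].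
pose hi : 'M[R]_(u + s) := \matrix_(i, j) sup [set Dmx F p i j | p in N].
have boxE A : in_box lo hi A <-> interval_enclosure F N A.
  by split => bA' i j; have := bA' i j; rewrite [lo i j]mxE [hi i j]mxE.
have [||||G GF Gbox] := @field_extension R (u + s) lo hi N F.
- by exists 0.
- by rewrite NE; exact: unit_cylinder_convex.
- by move=> x Nx; have [] := hF x (hNOm x Nx).
- by move=> x Nx; apply/boxE; exact: Dmx_enclosure hL Nx.
have [K K0 GK] := in_box_lipschitz Gbox.
have G0 : G 0 = 0 by rewrite GF.
have Gh : cone_rated G alpha_h^-1 c_h.
  move=> p q; have [A /boxE /hDF[a1 a2 a3 a4] ->] := Gbox p q.
  have [hx hy] := hcone _ _ _ _ a1 a4 a2 a3.
  apply: cone_rate => // z z0; first exact: (hx z z0).1.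
  by rewrite invrK; exact: (hy z z0).1.
have Gv : cone_rated G alpha_v c_v.
  move=> p q; have [A /boxE /hDF[a1 a2 a3 a4] ->] := Gbox p q.
  have [hx hy] := hcone _ _ _ _ a1 a4 a2 a3.
  apply: cone_rate => // z z0; first exact: (hx z z0).2.
  exact: (hy z z0).2.
(* differences of points of the manifold lie in the cone, which gives both
   uniqueness of the second component and the Lipschitz constant *)
have cone p q : strong_unstable Om F N c_v p -> strong_unstable Om F N c_v q ->
    sqn (dsubmx (p - q)) <= alpha_h * sqn (usubmx (p - q)).
  move=> Wp Wq; have := strong_unstable_cone hOm hF K0 GK GF bh0 hcvh Gh Wp Wq.
  by rewrite /cone_form subr_ge0 ler_pdivrMl.
have /choice[w wP] (x : 'cV[R]_u) : exists y : 'cV[R]_s, sqn x <= r_u ^+ 2 ->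
    strong_unstable Om F N c_v (col_mx x y) /\ sqn y <= 1.
  have [xr|nxr] := pselect (sqn x <= r_u ^+ 2); last by exists 0 => /nxr.
  have [g [Gg gx gV]] := backward_cone_curve K0 GK bh1 Gh G0 x.
  have g0 : sqn (usubmx (g 0)) <= 1 - alpha_v by rewrite gx -ru2.
  have dec := cone_curve_decay bh1 hav Gv G0 Gg gV g0.
  have e1 t : t <= 0 -> expR (2 * c_v * t) <= 1.
    by move=> t0; rewrite -expR0 ler_expR mulr_ge0_le0// mulr_ge0// ltW.
  have gN t : t <= 0 -> N (g t).
    move=> t0; have /andP[d1 d2] := dec t t0; rewrite NE; split.
      exact: le_trans (e1 t t0).
    by rewrite (le_trans d1)// (le_trans d2)// e1.
  exists (dsubmx (g 0)) => _; rewrite -gx vsubmxK; split.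
    apply: (@curve_strong_unstable R u s Om N F G hOm hF hNOm GF c_v 2) => // t t0.
    have /andP[d1 d2] := dec t t0.
    rewrite enorm_le ?mulr_ge0 ?expR_ge0// exprMn -expRM_natl sqn_split.
    have -> : 2%:R * (t * c_v) = 2 * c_v * t by ring.
    by have := expR_ge0 (2 * c_v * t); lra.
  by have := gN 0 (lexx 0); rewrite NE => -[].
exists w; split.
- move=> x; rewrite !closed_eballE//= expr1n => xr; exact: (wP x xr).2.
- rewrite hU; apply/seteqP; split => [p [Wp [xr _]]|_ [x xr <-]].
    move: xr; rewrite closed_eballE//= => p1.
    exists (usubmx p) => //.
    have [W' _] := wP _ p1.
    have := cone _ _ W' Wp; rewrite !linearB/= col_mxKu col_mxKd subrr sqn0 mulr0.
    by move=> /sqn_eq0/eqP; rewrite subr_eq0 => /eqP ->; rewrite vsubmxK.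
  move: (xr); rewrite closed_eballE//= => xr'; have [W' y1] := wP _ xr'.
  split => //; split => /=; first by rewrite col_mxKu.
  by rewrite col_mxKd closed_eballE//= expr1n.
- move=> x1 x2; rewrite !closed_eballE//= => /wP[W1 _] /wP[W2 _].
  have := cone _ _ W1 W2; rewrite !linearB/= !col_mxKu !col_mxKd => h.
  rewrite enorm_le ?mulr_ge0 ?sqrtr_ge0 ?enorm_ge0//.
  by rewrite exprMn sqr_sqrtr ?(ltW ah0)// sqr_enorm.
Qed.
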